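(* Let $(X,T)$ be a Polish dynamical system. If $U\subseteq\mathcal{M}_T(X)$ is open, then the set ${}^{U}G=\{x\in X: V(x)\cap U\neq\emptyset\}$ is analytic (is $\boldsymbol{\Sigma}^1_1$).
   Context: A Polish dynamical system $(X,T)$ is a Polish space $X$ (not assumed compact) with a continuous map $T\colon X\to X$. $\mathcal{M}(X)$ is the space of Borel probability measures on $X$ with the weak$^*$ topology (convergence of integrals of bounded continuous functions); $\mathcal{M}_T(X)$ is the subspace of $T$-invariant measures, and ''open'' means open in $\mathcal{M}_T(X)$. For $x\in X$, $n\ge1$, $\mathcal{E}(x,n)=\frac1n\sum_{j=0}^{n-1}\delta_{T^j(x)}$, and $V(x)$ is the set of limit points (limits of convergent subsequences) in $\mathcal{M}(X)$ of $(\mathcal{E}(x,n))_n$. *)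

(* Defs.v *)
From HB Require Import structures.
From mathcomp Require Import all_boot all_order all_algebra.
From mathcomp Require Import all_classical all_reals all_analysis.

Set Implicit Arguments.
Unset Strict Implicit.
Unset Printing Implicit Defensive.

Import Order.TTheory GRing.Theory Num.Theory.
Import numFieldNormedType.Exports.

Local Open Scope classical_set_scope.
Local Open Scope ring_scope.

Definition is_metric (R : realType) (X : Type) (d : X -> X -> R) : Prop :=
  [/\ forall x y, 0 <= d x y,
      forall x y, d x y = 0 <-> x = y,
      forall x y, d x y = d y x
    & forall x y z, d x z <= d x y + d y z].

Definition metrizes (R : realType) (X : topologicalType) (d : X -> X -> R)
    : Prop :=
  forall (x : X) (A : set X),
    nbhs x A <-> exists2 e : R, 0 < e & [set y | d x y < e] `<=` A.

Definition cauchy_sequence (R : realType) (X : Type) (d : X -> X -> R)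
    (u : nat -> X) : Prop :=
  forall e : R, 0 < e ->
    exists N : nat, forall m n, (N <= m)%N -> (N <= n)%N -> d (u m) (u n) < e.

Definition completely_metrizable (R : realType) (X : topologicalType) : Prop :=
  exists d : X -> X -> R, [/\ is_metric d, metrizes d
    & forall u : nat -> X, cauchy_sequence d u -> exists l : X, u @ \oo --> l].

Definition separable (X : topologicalType) : Prop :=
  exists2 D : set X, countable D & dense D.

Definition polish (R : realType) (X : topologicalType) : Prop :=
  separable X /\ completely_metrizable R X.

(* The space Y may be empty, so that set0 is analytic. *)
Definition analytic (R : realType) (X : topologicalType) (A : set X) : Prop :=
  exists (Y : topologicalType) (f : Y -> X),
    [/\ polish R Y, continuous f & range f = A].

Definition borel (X : ptopologicalType) := g_sigma_algebraType (@open X).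
HB.instance Definition _ (X : ptopologicalType) := Measurable.on (borel X).

Definition bounded_continuous (R : realType) (X : topologicalType) : Type :=
  {f : X -> R | continuous f /\ bounded_fun f}.

Definition integrals (R : realType) (X : ptopologicalType)
    (mu : probability (borel X) R) : {ptws bounded_continuous R X -> R} :=
  fun f => (\int[mu]_x (sval f : borel X -> R) x)%R.

(* The weak-star topology is the coarsest one making mu |-> \int f dmu
   continuous for every bounded continuous f, i.e. the initial topology for
   the map into the product of copies of R indexed by these f. *)
Definition prob_space (R : realType) (X : ptopologicalType) : Type :=
  initial_topology (@integrals R X).
HB.instance Definition _ (R : realType) (X : ptopologicalType) :=
  Topological.on (prob_space R X).

Definition invariant_measures (R : realType) (X : ptopologicalType)
    (T : X -> X) : set (prob_space R X) :=
  [set mu : probability (borel X) R |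
    forall A : set (borel X), measurable A -> mu (T @^-1` A) = mu A].

Section empirical.
Context (R : realType) (X : ptopologicalType) (T : X -> X) (x : X).

Definition empirical_measure (n : nat) : set (borel X) -> \bar R :=
  mscale (n%:R^-1)%:nng
    (msum (fun j => \d_(iter j T x : borel X) : measure (borel X) R) n).

HB.instance Definition _ n := Measure.on (empirical_measure n).

Lemma empirical_measureT n : empirical_measure n.+1 setT = 1%E.
Proof.
rewrite /empirical_measure /mscale/= /msum.
rewrite (eq_bigr (fun=> 1%E)); last by move=> j _; exact: diracT.
by rewrite sumEFin -EFinM sumr_const card_ord mulVf.
Qed.

HB.instance Definition _ n := Measure_isProbability.Build _ _ _
  (empirical_measure n.+1) (empirical_measureT n).

(* Shifted so that it enumerates the measures E(x, n) for n >= 1. *)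
Definition empirical_seq (n : nat) : prob_space R X :=
  (empirical_measure n.+1 : probability (borel X) R).

Definition limit_measures : set (prob_space R X) :=
  [set mu | exists2 phi : nat -> nat,
    {homo phi : m n / (m < n)%N} & empirical_seq (phi k) @[k --> \oo] --> mu].

End empirical.

Arguments analytic R {X} A.
Arguments invariant_measures R {X} T.
Arguments limit_measures R {X} T x.

(* Main.v *)
(* Weak convergence of measures on X is governed by the integrals of a countable
   family of test functions, so mu lies in V(x) iff, for some increasing phi, the
   integrals of the first k test functions against E(x, phi k) and against mu are
   2^-k-close.  This is a closed condition once mu is replaced by a code
   ranging over a Polish space.

   The code avoids the Polish topology of M(X).  Cut [0, 1[ into a tree of
   intervals I_s indexed by finite sequences of naturals, the children of a node
   exhausting it.  A point t selects a branch, and with each node is associated a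
   point of a dense sequence in such a way that points along a branch are Cauchy;
   their limit defines a Borel map xi : [0, 1[ -> X, and the code represents the
   law of xi under Lebesgue measure.  Every mu arises in this way, by ordering
   the codes of the points of X lexicographically and giving I_s the length
   mu (cell s).  If the endpoints of the intervals converge, the maps xi converge
   almost everywhere, whence the laws converge weakly by dominated convergence.

   Limits of empirical measures are automatically invariant, so U may be replaced
   by a weak*-open set of measures. *)

Require Import Defs.
From HB Require Import structures.
From mathcomp Require Import all_boot all_order all_algebra.
From mathcomp Require Import all_classical all_reals all_analysis.
From mathcomp Require Import measurable_realfun lra.

Set Implicit Arguments.
Unset Strict Implicit.
Unset Printing Implicit Defensive.

Import Order.TTheory GRing.Theory Num.Theory.
Import numFieldNormedType.Exports.

Local Open Scope classical_set_scope.
Local Open Scope ring_scope.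

(** * Projections of closed relations with countably many parameters *)

Section metric_lemmas.
Context {R : realType}.

Lemma exists_exprn2V_lt (e : R) : 0 < e -> exists m : nat, 2 ^- m < e.
Proof.
move=> e0; have [N _ /(_ N (leqnn N))] := near_infty_natSinv_expn_lt (PosNum e0).
by rewrite /= div1r => ?; exists N.
Qed.

Lemma exprn2V_gt0 m : 0 < 2 ^- m :> R.
Proof. by rewrite invr_gt0 exprn_gt0. Qed.

Lemma exprn2VS m : 2 ^- m.+1 = 2^-1 * 2 ^- m :> R.
Proof. by rewrite exprS invfM. Qed.

Lemma exprn2V_le m n : (m <= n)%N -> 2 ^- n <= 2 ^- m :> R.
Proof.
by move=> mn; rewrite lef_pV2 ?posrE ?exprn_gt0// ler_eXn2l// ltr1n.
Qed.

Lemma metrizes_cvgP (X : topologicalType) (d : X -> X -> R) (u : nat -> X) l :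
  metrizes d ->
  u @ \oo --> l <-> forall e, 0 < e -> \forall n \near \oo, d l (u n) < e.
Proof.
move=> md; split=> [ul e e0|h A /md[e e0 eA]].
  by apply: (ul [set y | d l y < e]); apply/md; exists e.
by apply: filterS (h _ e0) => n; exact: eA.
Qed.

(** Only finitely many [k] have a code below [p], so finitely many eventual properties are
    intersected. This gives uniform control of finitely many coordinates or test functions. *)
Lemma near_pickle_lt (K : countType) (P : K -> nat -> Prop) :
  (forall k, \forall j \near \oo, P k j) ->
  forall p, \forall j \near \oo, forall k, (pickle k < p)%N -> P k j.
Proof.
move=> hP; elim=> [|p IH]; first by apply: nearW.
have [[k kp]|nk] := pselect (exists k : K, pickle k = p).
  move: IH (hP k); apply: filterS2 => j IH Pk i.
  rewrite ltnS leq_eqVlt => /orP[|/IH//].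
  by rewrite -kp => /eqP/(pcan_inj pickleK) ->.
apply: filterS IH => j IH i; rewrite ltnS leq_eqVlt => /orP[/eqP ip|/IH//].
by exfalso; apply: nk; exists i.
Qed.

Lemma countable_range_countType (T : countType) (S : Type) (f : T -> S) :
  countable (range f).
Proof. exact: sub_countable (card_image_le _ _) (countableP _). Qed.

(** Lets a Polish space be presented by a bare type with a distance: the topology is generated from
    [D] inside the proof, and callers check density, completeness and continuity in metric terms. *)
Lemma analytic_range (X : topologicalType) (Y : Type) (D : Y -> Y -> R)
    (f : Y -> X) :
  is_metric D ->
  (exists2 Q : set Y, countable Q &
     forall y e, 0 < e -> exists2 q, Q q & D y q < e) ->
  (forall u, cauchy_sequence D u ->
     exists l, forall e, 0 < e -> \forall n \near \oo, D l (u n) < e) ->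
  (forall y A, nbhs (f y) A ->
     exists2 e, 0 < e & forall z, D y z < e -> A (f z)) ->
  analytic R (range f).
Proof.
move=> [D0 Deq Dsym Dtri] [Q cQ dQ] cplt fc.
have Dxx x : D x x = 0 by apply/Deq.
have Dpos x y : D x y = 0 -> x = y by move/Deq.
have Dtri' y x z : D x z <= D x y + D y z by [].
pose Yc : choiceType := HB.pack Y (gen_eqMixin Y) (gen_choiceMixin Y).
pose Y' : metricType R := HB.pack Y Yc (isMetric.Build R Yc Dxx Dpos Dsym Dtri').
have nbhsD : metrizes (D : Y' -> Y' -> R).
  by move=> x A; split=> [/nbhs_ballP[e /= e0 eA]|[e e0 eA]];
    [exists e|apply/nbhs_ballP; exists e].
exists Y', f; split => //.
- split.
    exists Q => // O [y Oy] oO.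
    have /nbhsD[e e0 eO] : nbhs y O by apply: open_nbhs_nbhs; split.
    by have [q Qq yq] := dQ y e e0; exists q; split => //; exact: eO.
  exists D; split => // u /cplt[l hl]; exists l.
  exact/(metrizes_cvgP _ _ nbhsD).
- move=> y A /fc[e e0 eA]; apply/nbhsD; exists e => // z; exact: eA.
Qed.

End metric_lemmas.

(** * A metric on a countable product of real lines *)

Section seqdist.
Context {R : realType} {K : countType}.
Implicit Types u v w : K -> R.

(** Induces the product topology: truncating coordinate [k] at [2 ^- pickle k] leaves finitely many
    coordinates to control at each scale. *)
Definition seqdist u v : R :=
  sup (range (fun k => Num.min (2 ^- pickle k) `|u k - v k|)).

Lemma le_seqdist u v k : Num.min (2 ^- pickle k) `|u k - v k| <= seqdist u v.
Proof.
apply: ub_le_sup; last by exists k.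
exists 1 => _ [j _ <-]; rewrite ge_min; apply/orP; left.
by have := @exprn2V_le R 0 (pickle j) isT; rewrite expr0 invr1.
Qed.

Lemma seqdist_le u v e : 0 <= e ->
  (forall k, Num.min (2 ^- pickle k) `|u k - v k| <= e) -> seqdist u v <= e.
Proof.
move=> e0 h; rewrite /seqdist.
(* [K] may be empty; the supremum is then that of the empty set, which is 0. *)
have [->|/set0P ne] := eqVneq
  (range (fun k => Num.min (2 ^- pickle k) `|u k - v k|)) set0.
  by rewrite sup0.
by apply: ge_sup => // _ [k _ <-]; exact: h.
Qed.

Lemma seqdist_ge0 u v : 0 <= seqdist u v.
Proof.
rewrite /seqdist; have [->|/set0P[_ [k _ _]]] := eqVneq
  (range (fun k => Num.min (2 ^- pickle k) `|u k - v k|)) set0.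
  by rewrite sup0.
apply: le_trans (le_seqdist u v k).
by rewrite le_min normr_ge0 andbT ltW// exprn2V_gt0.
Qed.

Lemma seqdist_coord u v k e : e <= 2 ^- pickle k -> seqdist u v < e ->
  `|u k - v k| < e.
Proof.
move=> ek uve; have := le_lt_trans (le_seqdist u v k) uve.
by rewrite gt_min => /orP[|//] /(le_lt_trans ek); rewrite ltxx.
Qed.

Lemma seqdist_metric : is_metric seqdist.
Proof.
split.
- exact: seqdist_ge0.
- move=> u v; split=> [uv|->]; last first.
    apply/le_anti; rewrite seqdist_ge0 andbT; apply: seqdist_le => // k.
    by rewrite subrr normr0 ge_min lexx orbT.
  apply/funext => k; apply/eqP; rewrite -subr_eq0 -normr_le0.
  apply: contraT; rewrite -ltNge => uvk.
  have := le_seqdist u v k.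
  by rewrite uv leNgt lt_min uvk exprn2V_gt0.
- move=> u v; rewrite /seqdist; congr sup; apply/eq_imagel => k _.
  by rewrite distrC.
- move=> u v w; apply: seqdist_le; first by rewrite addr_ge0// seqdist_ge0.
  move=> k; have := le_seqdist u v k; have := le_seqdist v w k.
  have := seqdist_ge0 u v; have := seqdist_ge0 v w.
  have := ler_distD (v k) (u k) (w k).
  rewrite !ge_min => h1 h2 h3 h4 h5.
  by case/orP : h4 => h4; case/orP : h5 => h5; apply/orP;
    [left|left|left|right]; lra.
Qed.

Lemma cvg_seqdist (u_ : nat -> K -> R) u :
  (forall k, u_ ^~ k @ \oo --> u k) ->
  forall e, 0 < e -> \forall n \near \oo, seqdist u (u_ n) < e.
Proof.
move=> uu e e0.
have [m me] := @exists_exprn2V_lt R (e / 2) ltac:(by rewrite divr_gt0).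
have H p : \forall n \near \oo, forall k, (pickle k < p)%N ->
    `|u k - u_ n k| < e / 2.
  apply: near_pickle_lt => k; have /cvgrPdist_lt/(_ (e / 2)) := uu k.
  by rewrite divr_gt0// => /(_ isT).
apply: filterS (H m) => n hn; apply: (@le_lt_trans _ _ (e / 2)); last lra.
apply: seqdist_le => [|k]; first lra.
rewrite ge_min; have [km|mk] := ltnP (pickle k) m.
  by rewrite (ltW (hn _ km)) orbT.
by rewrite (le_trans (exprn2V_le mk) (ltW me)).
Qed.

End seqdist.

Section projection.
Context {R : realType}.

Lemma cauchy_sequence_cvgn (w : nat -> R) :
  cauchy_sequence (fun a b => `|a - b|) w -> cvgn w.
Proof.
move=> cw; apply: cauchy_cvg; apply: cauchy_exP => e e0.
have [N hN] := cw e e0; exists (w N); exists N => // n /= Nn.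
exact: hN.
Qed.

Lemma dense_sequence (X : ptopologicalType) (d : X -> X -> R) :
  separable X -> metrizes d ->
  exists e : nat -> X, forall x r, 0 < r -> exists n, d x (e n) < r.
Proof.
move=> [D /countable_injP[f finj] dD] md.
(* A left inverse of the injection [f]. Off the image of [D] it returns the default point of [X],
   which does no harm to density. *)
exists (fun n => get [set x | D x /\ f x = n]) => x r r0.
have /md nx : exists2 e : R, 0 < e & [set y | d x y < e] `<=` [set y | d x y < r].
  by exists r.
have [y [xy Dy]] : [set y | d x y < r]^° `&` D !=set0.
  by apply: dD; [exists x|exact: open_interior].
exists (f y).
have [Dz fz] : [set z | D z /\ f z = f y] (get [set z | D z /\ f z = f y]).
  by apply: getPex; exists y.
have -> : get [set z | D z /\ f z = f y] = y by apply: finj => //; exact/mem_set.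
exact: (interior_subset xy).
Qed.

(* A countable set of parameters only adds a factor R^K, and sequential
   closedness suffices because everything in sight is metrizable. *)
Lemma analytic_projection_real (X : ptopologicalType) (K : countType)
    (C : X -> (K -> R) -> Prop) :
  polish R X ->
  (forall (x_ : nat -> X) (u_ : nat -> K -> R) x u, x_ @ \oo --> x ->
    (forall k, u_ ^~ k @ \oo --> u k) -> (forall j, C (x_ j) (u_ j)) -> C x u) ->
  analytic R [set x | exists u, C x u].
Proof.
move=> [sepX [d [dm md dc]]] closedC.
have [e he] := dense_sequence sepX md.
have [d0 deq dsym dtri] := dm.
have [r0 req rsym rtri] := @seqdist_metric R K.
(* The relation itself, with the maximum metric, is the Polish space; the set is its first
   projection. *)
pose Y := {z : X * (K -> R) | C z.1 z.2}.
pose D (y z : Y) := Num.max (d (sval y).1 (sval z).1)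
                            (seqdist (sval y).2 (sval z).2).
have -> : [set x | exists u, C x u] = range (fun y : Y => (sval y).1).
  apply/seteqP; split=> [x [u Cxu]|_ [[[x u] /= Cxu] _ <-]]; last by exists u.
  by exists (exist _ (x, u) Cxu).
apply: (analytic_range (D := D)).
- split.
  + by move=> y z; rewrite le_max d0.
  + move=> [[x u] yC] [[x' u'] zC]; rewrite /D/=; split.
      move=> /eqP; rewrite eq_le ge_max => /andP[/andP[h1 h2] _].
      have {h1}xx : x = x' by apply/deq/le_anti; rewrite h1 d0.
      have {h2}uu : u = u' by apply/req/le_anti; rewrite h2 r0.
      by move: xx uu yC zC => -> -> yC zC; congr exist; exact: Prop_irrelevance.
    move=> [-> ->]; have -> : d x' x' = 0 by apply/deq.
    by rewrite (proj2 (req u' u') erefl) maxxx.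
  + by move=> y z; rewrite /D dsym rsym.
  + move=> y z w; rewrite /D ge_max; apply/andP; split.
      by apply: le_trans (dtri _ (sval z).1 _) _; rewrite lerD// le_max lexx.
    by apply: le_trans (rtri _ (sval z).2 _) _; rewrite lerD// le_max lexx orbT.
(* Separability passes to the subspace: the sets [P q] are small neighbourhoods around countably
   many rational centres, and one point of [Y] is picked from each that is nonempty. *)
- pose P (q : nat * seq rat * nat) : set Y := [set y |
    d (sval y).1 (e q.1.1) < 2 ^- q.2 /\
    forall k, (pickle k < q.2)%N ->
      `|(sval y).2 k - ratr (nth 0 q.1.2 (pickle k))| < 2 ^- q.2].
  have [[y0 _]|Y0] := pselect (exists y : Y, True); last first.
    by exists set0 => // y; exfalso; apply: Y0; exists y.
  exists (range (fun q => xget (y0 : {classic Y}) (P q))).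
    exact: countable_range_countType.
  move=> y r rp.
  have [m mr] := @exists_exprn2V_lt R (r / 2) ltac:(by rewrite divr_gt0).
  have [i yi] := he (sval y).1 _ (@exprn2V_gt0 R m).
  have /choice[a ha] (k : K) :
      exists q : rat, `|(sval y).2 k - ratr q| < 2 ^- m.
    have p0 := @exprn2V_gt0 R m.
    have [q] := @rat_in_itvoo R ((sval y).2 k - 2 ^- m) ((sval y).2 k + 2 ^- m)
      ltac:(lra).
    rewrite in_itv/= => /andP[q1 q2]; exists q.
    by rewrite ltr_distl; apply/andP; split; lra.
  pose s := mkseq (fun p => if unpickle p is Some k then a k else 0) m.
  have Py : P (i, s, m) y.
    split => //= k km; rewrite nth_mkseq// pickleK; exact: ha.
  pose y' : Y := xget (y0 : {classic Y}) (P (i, s, m)).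
  exists y'; first by exists (i, s, m).
  have [/= h1 h2] : P (i, s, m) y' by apply: xgetPex; exists y.
  case: Py => /= g1 g2.
  rewrite /D gt_max; apply/andP; split.
    by have := dtri (sval y).1 (e i) (sval y').1; rewrite (dsym (e i)); lra.
  apply: (@le_lt_trans _ _ (2 * 2 ^- m)); last lra.
  apply: seqdist_le => [|k]; first by rewrite mulr_ge0// ltW// exprn2V_gt0.
  rewrite ge_min; have [km|mk] := ltnP (pickle k) m.
    apply/orP; right; have := g2 k km; have := h2 k km.
    have := ler_distD (ratr (nth 0 s (pickle k))) ((sval y).2 k) ((sval y').2 k).
    rewrite (distrC (ratr _)); lra.
  by apply/orP; left; have := @exprn2V_le R _ _ mk; have := @exprn2V_gt0 R m; lra.
- move=> u cu.
  have [x ux] : exists x : X, (fun n => (sval (u n)).1 : X) @ \oo --> x.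
    apply: dc => r rp; have [N hN] := cu r rp; exists N => m n Nm Nn.
    by have := hN m n Nm Nn; rewrite /D gt_max => /andP[].
  have /choice[w uw] (k : K) :
      exists a : R, (fun n => (sval (u n)).2 k) @ \oo --> a.
    suff /cvg_ex[a ?] : cvgn (fun n => (sval (u n)).2 k) by exists a.
    apply: cauchy_sequence_cvgn => r rp.
    (* Below [2 ^- pickle k] the truncation of coordinate [k] is inactive, so [seqdist] controls
       that coordinate. *)
    have mp : 0 < Num.min r (2 ^- pickle k) by rewrite lt_min rp exprn2V_gt0.
    have [N hN] := cu _ mp; exists N => m n Nm Nn.
    have := hN m n Nm Nn; rewrite /D gt_max => /andP[_].
    move/(@seqdist_coord R K _ _ k); rewrite ge_min lexx orbT => /(_ isT).
    by move/lt_le_trans; apply; rewrite ge_min lexx.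
  have Cxw : C x w by apply: closedC ux uw _ => j; exact: (svalP (u j)).
  exists (exist _ (x, w) Cxw : Y) => r rp.
  have /(metrizes_cvgP _ _ md)/(_ r rp) := ux.
  move: (cvg_seqdist uw rp); apply: filterS2 => n h1 h2.
  by rewrite /D/= gt_max h1 h2.
- move=> y A /md[r rp rA]; exists r => // z; rewrite /D gt_max => /andP[? _].
  exact: rA.
Qed.

(** The naturals form a closed discrete subset of the reals: two of them at distance less than 1
    coincide. *)
Lemma natr_cvgn_near (n_ : nat -> nat) (a : R) :
  (fun j => (n_ j)%:R) @ \oo --> a ->
  exists n, a = n%:R /\ \forall j \near \oo, n_ j = n.
Proof.
move=> na; have h2 : 0 < 2^-1 :> R by rewrite invr_gt0.
have /cvgrPdist_lt/(_ _ h2)[N _ hN] := na.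
have nN j : (N <= j)%N -> n_ j = n_ N.
  move=> Nj; have /= h1 := hN j Nj; have /= h3 := hN N (leqnn N).
  apply/eqP; rewrite -(eqr_nat R) -subr_eq0 -normr_eq0.
  have hlt : `|(n_ j)%:R - (n_ N)%:R| < 1 :> R.
    have := ler_distD a ((n_ j)%:R) ((n_ N)%:R); rewrite (distrC _ a).
    by move: h1 h3; lra.
  have [jN|jN|->] := ltngtP (n_ j) (n_ N); last by rewrite subrr normr0.
    move: hlt; rewrite distrC -natrB ?(ltnW jN)// normr_nat ltrn1 ltnS leqn0.
    by rewrite subn_eq0 leqNgt jN.
  move: hlt; rewrite -natrB ?(ltnW jN)// normr_nat ltrn1 ltnS leqn0.
  by rewrite subn_eq0 leqNgt jN.
have ev : \forall j \near \oo, n_ j = n_ N by exists N.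
exists (n_ N); split => //; apply: (cvg_unique _ na) => //.
by apply: cvg_near_cst; apply: filterS ev => j ->.
Qed.

(** Natural parameters are real ones constrained to a closed discrete set of values; convergence in
    such a coordinate means being eventually constant. *)
Lemma analytic_projection (X : ptopologicalType) (K K' : countType)
    (C : X -> (K -> R) -> (K' -> nat) -> Prop) :
  polish R X ->
  (forall (x_ : nat -> X) (u_ : nat -> K -> R) (v_ : nat -> K' -> nat) x u v,
    x_ @ \oo --> x -> (forall k, u_ ^~ k @ \oo --> u k) ->
    (forall k, \forall j \near \oo, v_ j k = v k) ->
    (forall j, C (x_ j) (u_ j) (v_ j)) -> C x u v) ->
  analytic R [set x | exists u v, C x u v].
Proof.
move=> pX closedC.
pose C' (x : X) (w : K + K' -> R) := exists v : K' -> nat,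
  (forall k, w (inr k) = (v k)%:R) /\ C x (w \o inl) v.
have -> : [set x | exists u v, C x u v] = [set x | exists w, C' x w].
  apply/seteqP; split=> [x [u [v Cx]]|x [w [v [_ ?]]]]; last first.
    by exists (w \o inl), v.
  by exists (fun k => match k with inl k => u k | inr k => (v k)%:R end), v.
apply: analytic_projection_real => // x_ w_ x w xx ww /choice[v_ hv].
have /choice[v vP] (k : K') :
    exists n, w (inr k) = n%:R /\ \forall j \near \oo, v_ j k = n.
  apply: natr_cvgn_near.
  have -> : (fun j => (v_ j k)%:R) = (fun j => w_ j (inr k)) :> (nat -> R).
    by apply/funext => j; have [->] := hv j.
  exact: ww.
exists v; split=> [k|]; first by have [] := vP k.
apply: (closedC x_ (fun j => w_ j \o inl) v_) => // [k|k|j].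
- exact: ww.
- by have [] := vP k.
- by have [] := hv j.
Qed.

End projection.

(** * Integrals and Borel measures *)

Section bounded_integrals.
Context {R : realType} (d1 : measure_display) (T1 : measurableType d1).
Implicit Types (P : probability T1 R) (f g : T1 -> R).

Lemma probability_bounded_integrable P f (M : R) :
  measurable_fun setT f -> (forall x, `|f x| <= M) ->
  P.-integrable setT (EFin \o f).
Proof.
move=> mf fM; apply: measurable_bounded_integrable => //.
  by rewrite (le_lt_trans (probability_le1 _ _))// ltry.
exists M; split; first exact: num_real.
by move=> N MN x _ /=; rewrite (le_trans (fM x))// ltW.
Qed.

Lemma probability_Rintegral_cvg P (f_ : nat -> T1 -> R) f (M : R) :
  (forall n, measurable_fun setT (f_ n)) -> measurable_fun setT f ->
  (forall n x, `|f_ n x| <= M) ->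
  {ae P, forall x, f_ ^~ x @ \oo --> f x} ->
  (\int[P]_x f_ n x) @[n --> \oo] --> \int[P]_x f x.
Proof.
move=> mf_ mf f_M ff.
have [] := @dominated_convergence _ _ _ P setT measurableT
  (fun n => EFin \o f_ n) (EFin \o f) (cst M%:E).
- by move=> n; exact/measurable_EFinP.
- exact/measurable_EFinP.
- by apply: filterS ff => x /= h _; apply/fine_cvgP; split => //; exact: nearW.
- have := @probability_bounded_integrable P (cst M) `|M|.
  by apply => // x; exact: lexx.
- by apply: aeW => x n _ /=; rewrite lee_fin.
move=> /integrableP[mF iF] _ h.
apply: fine_cvg; rewrite fineK//; apply: integrable_fin_num => //.
exact/integrableP.
Qed.

Context (d2 : measure_display) (T2 : measurableType d2).

Lemma pushforward_probability P (xi : T1 -> T2) :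
  measurable_fun setT xi ->
  exists mu : probability T2 R, forall A, mu A = P (xi @^-1` A).
Proof.
move=> mxi.
pose m0 := [the {measure set _ -> \bar _} of pushforward P xi].
pose m := m0 mxi.
have mT : m setT = 1%E by rewrite /m/= /pushforward preimage_setT probability_setT.
pose p : probability T2 R := HB.pack (m : set T2 -> \bar R) m
  (Measure_isProbability.Build _ _ _ m mT).
by exists p.
Qed.

Lemma Rintegral_image P (mu : probability T2 R) (xi : T1 -> T2) (f : T2 -> R)
    (M : R) :
  measurable_fun setT xi -> (forall A, measurable A -> mu A = P (xi @^-1` A)) ->
  measurable_fun setT f -> (forall x, `|f x| <= M) ->
  \int[mu]_x f x = \int[P]_x f (xi x).
Proof.
move=> mxi muP mf fM; rewrite /Rintegral; congr fine.
have := @integral_pushforward _ _ _ _ _ _ mxi P setT (EFin \o f).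
rewrite preimage_setT => <-//.
- by apply: eq_measure_integral => A mA _; exact: muP.
- exact/measurable_EFinP.
- rewrite -compA; apply: (@probability_bounded_integrable _ _ M).
    exact: measurableT_comp.
  by move=> x; exact: fM.
Qed.

End bounded_integrals.

Section borel.
Context {R : realType} {X : ptopologicalType}.

Lemma borel_open (A : set X) : open A -> measurable (A : set (borel X)).
Proof. exact: sub_sigma_algebra. Qed.

Lemma borel_measurable_fun (d0 : measure_display) (S : measurableType d0)
    (f : S -> borel X) :
  (forall A : set X, open A -> measurable (f @^-1` A)) -> measurable_fun setT f.
Proof.
move=> h; have mE : measurable = <<s @open X : set (set (borel X))>> by [].
apply: (measurability _ mE) => _ [A oA <-].
by rewrite setTI; exact: h.
Qed.

Lemma continuous_borel (f : X -> R) : continuous f ->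
  measurable_fun setT (f : borel X -> R).
Proof.
move=> /continuousP cf.
apply: (measurability _ (RGenOpens.measurableE R)).
move=> _ [_ [a [b ->] <-]]; rewrite setTI; apply: borel_open; apply: cf.
exact: interval_open.
Qed.

(** The open sets generate the Borel sets and are stable under intersection. *)
Lemma eq_borel_probability (m1 m2 : probability (borel X) R) :
  (forall A : set X, open A -> m1 A = m2 A) ->
  forall A : set (borel X), measurable A -> m1 A = m2 A.
Proof.
move=> h A mA.
have mE : measurable = <<s @open X : set (set (borel X))>> by [].
apply: (measure_unique _ (fun=> setT) mE) => //.
- exact: openI.
- by move=> _; exact: openT.
- by rewrite bigcup_const.
- by move=> _; apply: le_lt_trans (probability_le1 _ _) _; rewrite ?ltry.
Qed.

End borel.

(** * Laws of countably valued maps *)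

Section countably_valued.
Context {R : realType} {S : countType}.

Lemma countable_preimage_cases (T : Type) (f : T -> S) (Q : set S) n :
  [set t | Q (f t) /\ pickle (f t) = n] = set0 \/
  exists s, [set t | Q (f t) /\ pickle (f t) = n] = [set t | f t = s].
Proof.
have [[s [Qs <-]]|nQ] := pselect (exists s, Q s /\ pickle s = n); last first.
  by left; apply/seteqP; split=> // t h; apply: nQ; exists (f t).
by right; exists s; apply/seteqP; split=> t /= => [[_ /(pcan_inj pickleK)]|->].
Qed.

Lemma countably_valued_preimage (T : Type) (f : T -> S) (Q : set S) :
  [set t | Q (f t)] = \bigcup_n [set t | Q (f t) /\ pickle (f t) = n].
Proof.
by apply/seteqP; split=> [t Qt|t [n _ []//]]; exists (pickle (f t)).
Qed.

Lemma countably_valued_measurable (d1 : measure_display)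
    (T1 : measurableType d1) (f : T1 -> S) (Q : set S) :
  (forall s, measurable [set t | f t = s]) -> measurable [set t | Q (f t)].
Proof.
move=> mf; rewrite countably_valued_preimage; apply: bigcupT_measurable => n.
by have [->|[s ->]] := countable_preimage_cases f Q n.
Qed.

(** By countable additivity, masses of points determine the law. Values are enumerated through
    [pickle], and a number coding no value in [Q] contributes the empty set. *)
Lemma eq_countably_valued_law (d1 d2 : measure_display)
    (T1 : measurableType d1) (T2 : measurableType d2)
    (m1 : probability T1 R) (m2 : probability T2 R)
    (f1 : T1 -> S) (f2 : T2 -> S) :
  (forall s, measurable [set t | f1 t = s]) ->
  (forall s, measurable [set t | f2 t = s]) ->
  (forall s, m1 [set t | f1 t = s] = m2 [set t | f2 t = s]) ->
  forall Q : set S, m1 [set t | Q (f1 t)] = m2 [set t | Q (f2 t)].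
Proof.
move=> mf1 mf2 m12 Q.
have mF (d0 : measure_display) (T0 : measurableType d0) (f : T0 -> S) :
    (forall s, measurable [set t | f t = s]) ->
    forall n, measurable [set t | Q (f t) /\ pickle (f t) = n].
  by move=> mf n; have [->|[s ->]] := countable_preimage_cases f Q n.
have tF (T0 : Type) (f : T0 -> S) :
    trivIset setT (fun n => [set t | Q (f t) /\ pickle (f t) = n]).
  apply/trivIsetP => i j _ _ ij; apply/seteqP; split=> // t [[_ ti] [_ tj]].
  by move: ij; rewrite -ti -tj eqxx.
have M (d0 : measure_display) (T0 : measurableType d0) (m : probability T0 R)
    (f : T0 -> S) : (forall s, measurable [set t | f t = s]) ->
    m [set t | Q (f t)] =
    (\sum_(n <oo) m [set t | Q (f t) /\ pickle (f t) = n])%E.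
  move=> mf; rewrite countably_valued_preimage; apply: measure_semi_bigcup.
  - exact: mF.
  - exact: tF.
  - by apply: bigcupT_measurable; exact: mF.
rewrite !M//; apply: eq_eseriesr => n _.
have [[s [Qs sn]]|nQ] := pselect (exists s, Q s /\ pickle s = n).
  have E (T0 : Type) (f : T0 -> S) :
      [set t | Q (f t) /\ pickle (f t) = n] = [set t | f t = s].
    apply/seteqP; split=> t /= => [[_]|->//].
    by rewrite -sn => /(pcan_inj pickleK).
  by rewrite !E.
have E (T0 : Type) (f : T0 -> S) :
    [set t | Q (f t) /\ pickle (f t) = n] = set0.
  by apply/seteqP; split=> // t h; apply: nQ; exists (f t).
by rewrite !E !measure0.
Qed.

End countably_valued.

(** * Trees of intervals *)

Section interval_tree.
Context {R : realType}.
Implicit Types (L : seq nat -> R) (s : seq nat) (t : R).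

(* Nodes are sequences written backwards: the children of s are the n :: s. *)
Definition right_end L s : R := if s is n :: s' then L (n.+1 :: s') else 1.

(** Only left endpoints are recorded: an interval ends where its next sibling begins, so siblings
    are adjacent. Intervals may be empty. The last clause forbids a gap between the children and the
    right end of their parent. *)
Record interval_tree L : Prop := IntervalTree {
  itree_root : L [::] = 0;
  itree_first : forall s, L (0%N :: s) = L s;
  itree_mono : forall s n, L (n :: s) <= L (n.+1 :: s);
  itree_right : forall s n, L (n :: s) <= right_end L s;
  itree_exhaust : forall s m, exists n, right_end L s - L (n :: s) <= 2 ^- m }.

Definition in_node L s t := L s <= t < right_end L s.

(** Total in [t]: outside [[0, 1[] no child contains [t] and [get] returns the default label. *)
Fixpoint branch L t m : seq nat :=
  if m is m'.+1
  then get [set n | in_node L (n :: branch L t m') t] :: branch L t m'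
  else [::].

Lemma size_branch L t m : size (branch L t m) = m.
Proof. by elim: m => //= m ->. Qed.

Lemma itree_le L s m n : interval_tree L -> (m <= n)%N -> L (m :: s) <= L (n :: s).
Proof.
move=> tL; elim: n => [|n IH]; first by rewrite leqn0 => /eqP ->.
rewrite leq_eqVlt => /orP[/eqP -> //|]; rewrite ltnS => /IH/le_trans; apply.
exact: itree_mono.
Qed.

Lemma itree_left L s n : interval_tree L -> L s <= L (n :: s).
Proof. by move=> tL; rewrite -(itree_first tL s); exact: itree_le. Qed.

Lemma in_node_parent L s n t : interval_tree L -> in_node L (n :: s) t ->
  in_node L s t.
Proof.
move=> tL /andP[Lt tr]; apply/andP; split.
  exact: le_trans (itree_left s n tL) Lt.
exact: lt_le_trans tr (itree_right tL s n.+1).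
Qed.

Lemma in_node01 L s t : interval_tree L -> in_node L s t -> 0 <= t < 1.
Proof.
move=> tL; elim: s => [|n s IH]; first by rewrite /in_node itree_root.
by move/(in_node_parent tL)/IH.
Qed.

Lemma itree_le_right L s : interval_tree L -> L s <= right_end L s.
Proof.
by move=> tL; rewrite -(itree_first tL s); exact: itree_right.
Qed.

Lemma in_node_child L s t : interval_tree L -> in_node L s t ->
  exists n, in_node L (n :: s) t.
Proof.
move=> tL /andP[Lt tr].
have ex : exists n, t < L (n.+1 :: s).
  have [m mt] := @exists_exprn2V_lt R (right_end L s - t)
    ltac:(by rewrite subr_gt0).
  have [n hn] := itree_exhaust tL s m.
  by exists n; apply: lt_le_trans (itree_mono tL s n); lra.
(* By minimality [t] is not to the left of child [n]; for [n = 0] this holds because the first child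
   starts where its parent does. *)
case: (ex_minnP ex) => n tn nmin; exists n; rewrite /in_node/= tn andbT.
case: n => [|n] in tn nmin *; first by rewrite itree_first.
by rewrite leNgt; apply/negP => /nmin; rewrite ltnn.
Qed.

Lemma in_node_inj L s s' t : interval_tree L -> size s = size s' ->
  in_node L s t -> in_node L s' t -> s = s'.
Proof.
move=> tL; elim: s s' => [|n s IH] [|n' s']//= [ss'] h h'.
have ? : s = s' by exact: IH ss' (in_node_parent tL h) (in_node_parent tL h').
subst s'; congr (_ :: _); move: h h' => /andP[/= h1 h2] /andP[/= h3 h4].
have [nn'|nn'|//] := ltngtP n n'.
  by have := le_lt_trans (le_trans (itree_le s tL nn') h3) h2; rewrite ltxx.
by have := le_lt_trans (le_trans (itree_le s tL nn') h1) h4; rewrite ltxx.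
Qed.

Lemma in_node_branch L t m : interval_tree L -> 0 <= t < 1 ->
  in_node L (branch L t m) t.
Proof.
move=> tL t01; elim: m => [|m IH] /=; first by rewrite /in_node itree_root.
by have /getPex := in_node_child tL IH.
Qed.

Lemma branchP L t s : interval_tree L -> 0 <= t < 1 ->
  branch L t (size s) = s <-> in_node L s t.
Proof.
move=> tL t01; split=> [<-|h]; first exact: in_node_branch.
by apply: in_node_inj tL _ (in_node_branch _ tL t01) h; rewrite size_branch.
Qed.

Lemma branch_out L t m : interval_tree L -> ~~ (0 <= t < 1) ->
  branch L t m = nseq m point.
Proof.
move=> tL t01; elim: m => //= m IH; rewrite {2}IH; congr (_ :: _).
by apply: getPN => n /(in_node01 tL); apply/negP.
Qed.

Lemma measurable_branch L m (Q : set (seq nat)) : interval_tree L ->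
  measurable [set t | Q (branch L t m)].
Proof.
move=> tL; apply: countably_valued_measurable => s.
have [sm|sm] := eqVneq (size s) m; last first.
  rewrite (_ : [set _ | _] = set0)//; apply/seteqP; split => // t /= ts.
  by move: sm; rewrite -ts size_branch eqxx.
(* The fibre is the interval of [s], together with the complement of [[0, 1[] when [s] is the
   default branch. *)
have -> : [set t | branch L t m = s] =
   `[L s, right_end L s[%classic `|`
   (~` `[0, 1[%classic `&` [set t | nseq m point = s]).
  apply/seteqP; split=> [t /= bs|t [|[t01 ms]]] /=.
  - have [t01|t01] := boolP (0 <= t < 1).
      by left; rewrite in_itv/=; move: bs; rewrite -sm => /(branchP _ tL t01).
    by right; rewrite in_itv/= -bs branch_out//; split => //; exact/negP.
  - rewrite in_itv/= => h; have t01 := in_node01 tL h.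
    by rewrite -sm; apply/(branchP _ tL t01).
  - rewrite branch_out//; apply/negP; move: t01; rewrite /= in_itv/=.
    by [].
apply: measurableU; first exact: measurable_itv.
apply: measurableI; first by apply: measurableC; exact: measurable_itv.
have [ms|ms] := pselect (nseq m point = s).
  by rewrite (_ : [set _ | _] = setT)//; apply/seteqP; split.
by rewrite (_ : [set _ | _] = set0)//; apply/seteqP; split.
Qed.

(** A point that is no endpoint lies strictly inside its interval at depth [m], and strict
    inequalities survive small changes of the endpoints. *)
Lemma branch_near L (L_ : nat -> seq nat -> R) t m : interval_tree L ->
  (forall j, interval_tree (L_ j)) ->
  (forall s, L_ ^~ s @ \oo --> L s) -> 0 <= t < 1 -> ~ range L t ->
  \forall j \near \oo, branch (L_ j) t m = branch L t m.
Proof.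
move=> tL tL_ LL t01 nt.
have := in_node_branch m tL t01; set s := branch L t m => /andP[h1 h2].
have sm : size s = m by rewrite size_branch.
have lt1 : L s < t.
  by rewrite lt_neqAle h1 andbT; apply/eqP => st; apply: nt; exists s.
have n1 : \forall j \near \oo, L_ j s < t by apply: cvgr_lt (LL s) _ lt1.
have n2 : \forall j \near \oo, t < right_end (L_ j) s.
  case: (s) h2 => [|n s'] /= h2; first exact: nearW.
  exact: cvgr_gt (LL _) _ h2.
move: n1 n2; apply: filterS2 => j j1 j2.
by rewrite -{1}sm; apply/(branchP _ (tL_ j) t01); rewrite /in_node ltW.
Qed.

End interval_tree.

Section unit_probability.
Context {R : realType}.

Lemma unit_probability_ex : exists P : probability (measurableTypeR R) R,
  forall A, P A = lebesgue_measure (A `&` `[0, 1[%classic).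
Proof.
have mI : measurable (`[0, 1[%classic : set (measurableTypeR R)).
  exact: measurable_itv.
pose m : {measure set (measurableTypeR R) -> \bar R} := mrestr lebesgue_measure mI.
have mT : m setT = 1%E.
  by rewrite /m/= /mrestr setTI lebesgue_measure_itv/= lte_fin ltr01 oppr0 adde0.
pose p : probability (measurableTypeR R) R := HB.pack (m : set _ -> \bar R) m
  (Measure_isProbability.Build _ _ _ m mT).
by exists p.
Qed.

Definition unit_probability := projT1 (cid unit_probability_ex).

Lemma unit_probabilityE A :
  unit_probability A = lebesgue_measure (A `&` `[0, 1[%classic).
Proof. exact: (projT2 (cid unit_probability_ex)). Qed.

End unit_probability.

(** * Coding probability measures by trees *)

Section representation.
Context {R : realType} {X : ptopologicalType} (d : X -> X -> R) (e : nat -> X).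
Hypothesis dm : is_metric d.
Hypothesis md : metrizes d.
Hypothesis dc : forall u, cauchy_sequence d u -> exists l : X, u @ \oo --> l.
Hypothesis d_le1 : forall x y, d x y <= 1.
Hypothesis de : forall x r, 0 < r -> exists n, d x (e n) < r.

Let d_sym x y : d x y = d y x. Proof. by case: dm. Qed.
Let d_tri x y z : d x z <= d x y + d y z. Proof. by case: dm. Qed.
Let d_refl x : d x x = 0. Proof. by case: dm => _ h _ _; apply/h. Qed.

(* The jump is ignored when it is too long, so that the points along any branch
   form a Cauchy sequence and no compatibility condition on trees is needed. *)
Fixpoint node_point (s : seq nat) : X :=
  if s is n :: s' then
    if d (node_point s') (e n) < 3 * 2 ^- size s' then e n else node_point s'
  else e 0.

Lemma node_point_step n s :
  d (node_point s) (node_point (n :: s)) <= 3 * 2 ^- size s.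
Proof.
rewrite /=; case: ifPn => [/ltW//|_]; rewrite d_refl.
by rewrite mulr_ge0// ltW// exprn2V_gt0.
Qed.

(** The radius is the sum of the allowed jumps [3 * 2 ^- k] for [k >= m]: it bounds the distance
    from a node at depth [m] to the limit of any branch through it. *)
Definition node_inside (G : set X) (m : nat) : set (seq nat) :=
  [set s | forall y, d (node_point s) y <= 6 * 2 ^- m -> G y].

(** * Points coded by growing sequences of nodes *)

Section coding.
Context {T : Type} (b : T -> nat -> seq nat) (zeta : T -> X).
Hypothesis bS : forall t m, exists n, b t m.+1 = n :: b t m.
Hypothesis sizeb : forall t m, size (b t m) = m.

(** The jumps [3 * 2 ^- k] sum to exactly this difference, which makes the induction close. *)
Lemma coding_dist t m n : (m <= n)%N ->
  d (node_point (b t m)) (node_point (b t n)) <= 6 * (2 ^- m - 2 ^- n).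
Proof.
move=> /subnK <-; elim: (n - m)%N => [|k IH].
  by rewrite add0n d_refl subrr mulr0.
rewrite addSn; have [j ->] := bS t (k + m).
have := d_tri (node_point (b t m)) (node_point (b t (k + m)))
  (node_point (j :: b t (k + m))).
have := node_point_step j (b t (k + m)); rewrite sizeb.
have := @exprn2VS R (k + m); lra.
Qed.

Lemma coding_limit t :
  exists x, forall m, d (node_point (b t m)) x <= 6 * 2 ^- m.
Proof.
have [x ux] : exists x : X, (fun m => node_point (b t m)) @ \oo --> x.
  apply: dc => r r0.
  have [N Nr] := @exists_exprn2V_lt R (r / 12) ltac:(by rewrite divr_gt0).
  exists N => m n Nm Nn.
  have := d_tri (node_point (b t m)) (node_point (b t N)) (node_point (b t n)).
  rewrite (d_sym (node_point (b t m)) (node_point (b t N))).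
  have := coding_dist t Nm; have := coding_dist t Nn.
  have := @exprn2V_gt0 R m; have := @exprn2V_gt0 R n; lra.
exists x => m; apply/ler_addgt0Pr => r r0.
have /(metrizes_cvgP _ _ md)/(_ r r0)[N _ hN] := ux.
have := hN (maxn m N) (leq_maxr m N); rewrite /= d_sym.
have := coding_dist t (leq_maxl m N).
have := d_tri (node_point (b t m)) (node_point (b t (maxn m N))) x.
have := @exprn2V_gt0 R (maxn m N); lra.
Qed.

Hypothesis bz : forall t m, d (node_point (b t m)) (zeta t) <= 6 * 2 ^- m.

Lemma coding_preimage_open (G : set X) : open G ->
  zeta @^-1` G = \bigcup_m [set t | node_inside G m (b t m)].
Proof.
move=> oG; apply/seteqP; split=> [t Gt|t [m _]]; last first.
  by move/(_ (zeta t)); apply; exact: bz.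
have /md[r r0 rG] : nbhs (zeta t) G by apply: open_nbhs_nbhs; split.
(* Two distances of at most [6 * 2 ^- m] will be added, hence the twelfth. *)
have [m mr] := @exists_exprn2V_lt R (r / 12) ltac:(by rewrite divr_gt0).
exists m => // y hy; apply: rG => /=.
have := d_tri (zeta t) (node_point (b t m)) y.
rewrite (d_sym (zeta t) (node_point _)).
have := bz t m; lra.
Qed.

(** The balls along a branch are nested: [3 * 2 ^- m + 6 * 2 ^- m.+1 = 6 * 2 ^- m]. *)
Lemma coding_nondecreasing (G : set X) :
  nondecreasing_seq (fun m => [set t | node_inside G m (b t m)]).
Proof.
apply/nondecreasing_seqP => m; apply/subsetPset => t /= h y hy; apply: h.
have [n bn] := bS t m; move: hy; rewrite bn => hy.
have := node_point_step n (b t m); rewrite sizeb.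
have := d_tri (node_point (b t m)) (node_point (n :: b t m)) y.
by move: hy; rewrite exprn2VS; lra.
Qed.

End coding.

(** The mass of an open set is the limit of the masses of the events [node_inside] at depth [m], and
    these depend only on the laws of the finite sequences. *)
Lemma eq_coding_law (d1 d2 : measure_display) (T1 : measurableType d1)
    (T2 : measurableType d2) (m1 : probability T1 R) (m2 : probability T2 R)
    (b1 : T1 -> nat -> seq nat) (b2 : T2 -> nat -> seq nat)
    (z1 : T1 -> X) (z2 : T2 -> X) :
  (forall t m, exists n, b1 t m.+1 = n :: b1 t m) ->
  (forall t m, exists n, b2 t m.+1 = n :: b2 t m) ->
  (forall t m, size (b1 t m) = m) -> (forall t m, size (b2 t m) = m) ->
  (forall t m, d (node_point (b1 t m)) (z1 t) <= 6 * 2 ^- m) ->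
  (forall t m, d (node_point (b2 t m)) (z2 t) <= 6 * 2 ^- m) ->
  (forall m s, measurable [set t | b1 t m = s]) ->
  (forall m s, measurable [set t | b2 t m = s]) ->
  (forall m s, m1 [set t | b1 t m = s] = m2 [set t | b2 t m = s]) ->
  forall G, open G -> m1 (z1 @^-1` G) = m2 (z2 @^-1` G).
Proof.
move=> bS1 bS2 sz1 sz2 bz1 bz2 mb1 mb2 b12 G oG.
have F (d0 : measure_display) (T0 : measurableType d0) (P : probability T0 R)
    (b : T0 -> nat -> seq nat) (z : T0 -> X) :
    (forall t m, exists n, b t m.+1 = n :: b t m) ->
    (forall t m, size (b t m) = m) ->
    (forall t m, d (node_point (b t m)) (z t) <= 6 * 2 ^- m) ->
    (forall m s, measurable [set t | b t m = s]) ->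
    P [set t | node_inside G m (b t m)] @[m --> \oo] --> P (z @^-1` G).
  move=> bS sz bz mb; rewrite (coding_preimage_open bz)//.
  have mN m : measurable [set t | node_inside G m (b t m)].
    exact: countably_valued_measurable.
  apply: nondecreasing_cvg_mu => //; first exact: bigcupT_measurable.
  exact: coding_nondecreasing.
have h1 := F _ _ m1 b1 z1 bS1 sz1 bz1 mb1.
have h2 := F _ _ m2 b2 z2 bS2 sz2 bz2 mb2.
apply: (cvg_unique _ h1) => //; rewrite (_ : (fun m => _) =
  (fun m => m2 [set t | node_inside G m (b2 t m)]))//.
by apply/funext => m; exact: eq_countably_valued_law.
Qed.

Definition tree_map (L : seq nat -> R) (t : R) : X :=
  get [set x | forall m, d (node_point (branch L t m)) x <= 6 * 2 ^- m].

Let branchS L (t : R) m : exists n, branch L t m.+1 = n :: branch L t m.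
Proof. by eexists. Qed.

Lemma tree_map_dist L t m :
  d (node_point (branch L t m)) (tree_map L t) <= 6 * 2 ^- m.
Proof.
by have /getPex := coding_limit (branchS L) (size_branch L) t; exact.
Qed.

Lemma measurable_tree_map L : interval_tree L ->
  measurable_fun setT (tree_map L : measurableTypeR R -> borel X).
Proof.
move=> tL; apply: borel_measurable_fun => A oA.
rewrite (coding_preimage_open (tree_map_dist L))//.
apply: bigcupT_measurable => m; exact: measurable_branch.
Qed.

Definition tree_law L (mu : probability (borel X) R) :=
  forall A : set (borel X), measurable A ->
    mu A = unit_probability (tree_map L @^-1` A).

Lemma tree_law_ex L : interval_tree L -> exists mu, tree_law L mu.
Proof.
move=> /measurable_tree_map mL.
have [mu muE] := pushforward_probability unit_probability mL.
by exists mu => A _; exact: muE.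
Qed.

Lemma tree_law_integral L mu (f : X -> R) M :
  interval_tree L -> tree_law L mu -> continuous f -> (forall x, `|f x| <= M) ->
  \int[mu]_x (f : borel X -> R) x = \int[unit_probability]_t f (tree_map L t).
Proof.
move=> tL muL cf fM.
exact: (Rintegral_image (measurable_tree_map tL) muL (continuous_borel cf) fM).
Qed.

(** Once the branches agree down to depth [m], their limits are within [12 * 2 ^- m]. *)
Lemma tree_map_cvg L (L_ : nat -> seq nat -> R) t : interval_tree L ->
  (forall j, interval_tree (L_ j)) -> (forall s, L_ ^~ s @ \oo --> L s) ->
  0 <= t < 1 -> ~ range L t ->
  tree_map (L_ j) t @[j --> \oo] --> tree_map L t.
Proof.
move=> tL tL_ LL t01 nt; apply/(metrizes_cvgP _ _ md) => r r0.
have [m mr] := @exists_exprn2V_lt R (r / 12) ltac:(by rewrite divr_gt0).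
apply: filterS (branch_near m tL tL_ LL t01 nt) => j jm.
have := tree_map_dist (L_ j) t m; rewrite jm.
have := tree_map_dist L t m.
have := d_tri (tree_map L t) (node_point (branch L t m)) (tree_map (L_ j) t).
rewrite (d_sym (tree_map L t) (node_point _)); lra.
Qed.

Lemma tree_integral_cvg L (L_ : nat -> seq nat -> R) (f : X -> R) M :
  interval_tree L -> (forall j, interval_tree (L_ j)) ->
  (forall s, L_ ^~ s @ \oo --> L s) ->
  continuous f -> (forall x, `|f x| <= M) ->
  \int[unit_probability]_t f (tree_map (L_ j) t) @[j --> \oo] -->
  \int[unit_probability]_t f (tree_map L t).
Proof.
move=> tL tL_ LL cf fM.
have mfL L' : interval_tree L' ->
    measurable_fun setT (fun t : measurableTypeR R => f (tree_map L' t)).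
  move=> tL'; apply: measurableT_comp (measurable_tree_map tL').
  exact: continuous_borel.
apply: (@probability_Rintegral_cvg _ _ _ _ _ _ M) => //.
- by move=> j; exact: mfL.
- exact: mfL.
have cL : countable (range L) by exact: countable_range_countType.
(* The exceptional set is null: the sample measure lives on [[0, 1[], and a tree has countably many
   endpoints. *)
exists (~` `[0, 1[%classic `|` range L); split.
- apply: measurableU; first by apply: measurableC; exact: measurable_itv.
  by apply: countable_measurable.
- apply/eqP; rewrite eq_le measure_ge0 andbT unit_probabilityE.
  rewrite setIUl setICl set0U.
  apply: (@le_trans _ _ (lebesgue_measure (range L))).
    apply: le_measure; rewrite ?inE.
    + by apply: measurableI; [exact: countable_measurable|exact: measurable_itv].
    + exact: countable_measurable.
    + exact: subIsetl.
  by rewrite countable_lebesgue_measure0.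
- move=> t /= nt; apply: contrapT => /not_orP[/contrapT].
  rewrite in_itv/= => t01 ntL.
  by apply: nt; apply: (cvg_comp _ _ (tree_map_cvg tL tL_ LL t01 ntL)); exact: cf.
Qed.

(** Taking the least index makes each event [code_at m x < n] a finite union of open balls, so codes
    are Borel. *)
Definition code_at m x : nat := ex_minn (de x (exprn2V_gt0 m)).

Lemma code_at_dist m x : d x (e (code_at m x)) < 2 ^- m.
Proof. by rewrite /code_at; case: ex_minnP. Qed.

Lemma code_at_lt m x n :
  (code_at m x < n)%N <-> exists2 k, (k < n)%N & d x (e k) < 2 ^- m.
Proof.
rewrite /code_at; case: ex_minnP => c hc cmin.
by split=> [cn|[k kn /cmin ck]]; [exists c|exact: leq_ltn_trans ck kn].
Qed.

Lemma metric_ball_open x r : open [set y | d y x < r].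
Proof.
rewrite openE => y /= yx; apply/md; exists (r - d y x); first by rewrite subr_gt0.
by move=> z /= yz; have := d_tri z y x; rewrite (d_sym z y); lra.
Qed.

Lemma measurable_code_lt m n :
  measurable ([set x | (code_at m x < n)%N] : set (borel X)).
Proof.
have -> : [set x | (code_at m x < n)%N] =
    \bigcup_(k in [set k | (k < n)%N]) [set x | d x (e k) < 2 ^- m].
  by apply/seteqP; split=> [x /code_at_lt[k]|x [k kn xk]];
    [exists k|apply/code_at_lt; exists k].
apply: bigcup_measurable => k _; apply: borel_open; exact: metric_ball_open.
Qed.

Fixpoint code x m : seq nat :=
  if m is m'.+1 then code_at m' x :: code x m' else [::].

Lemma size_code x m : size (code x m) = m.
Proof. by elim: m => //= m ->. Qed.

Let codeS x m : exists n, code x m.+1 = n :: code x m.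
Proof. by eexists. Qed.

(** Along a code no jump is ignored: consecutive approximations differ by less than
    [2 ^- m + 2 ^- m.+1 = 3 * 2 ^- m.+1], the threshold at depth [m.+1]. The first jump passes
    because [d] is at most 1. *)
Lemma node_point_code x m : node_point (code x m.+1) = e (code_at m x).
Proof.
elim: m => [|m IH]; first by rewrite /= ifT// (le_lt_trans (d_le1 _ _))//; lra.
rewrite -[LHS]/(if d (node_point (code x m.+1)) (e (code_at m.+1 x)) <
    3 * 2 ^- size (code x m.+1) then e (code_at m.+1 x)
  else node_point (code x m.+1)) IH size_code ifT//.
have := d_tri (e (code_at m x)) x (e (code_at m.+1 x)).
rewrite (d_sym (e _) x); have := code_at_dist m x; have := code_at_dist m.+1 x.
by have := @exprn2VS R m; lra.
Qed.

Lemma code_dist x m : d (node_point (code x m)) x <= 6 * 2 ^- m.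
Proof.
case: m => [|m].
  by rewrite expr0 invr1; have := d_le1 (node_point (code x 0)) x; lra.
rewrite node_point_code d_sym; have := code_at_dist m x; have := @exprn2VS R m.
by have := @exprn2V_gt0 R m; lra.
Qed.

Definition cell s : set (borel X) := [set x | code x (size s) = s].

Lemma measurable_cell s : measurable (cell s).
Proof.
elim: s => [|n s IH].
  by rewrite (_ : cell _ = setT)//; apply/seteqP; split.
have -> : cell (n :: s) = cell s `&` ([set x | (code_at (size s) x < n.+1)%N] `\`
    [set x | (code_at (size s) x < n)%N]).
  apply/seteqP; split=> [x [cn cs]|x [cs [/= h1 h2]]].
    by split => //; split; rewrite /= cn ?ltnn.
  rewrite /cell/=; congr (_ :: _) => //.
  by apply/eqP; rewrite eqn_leq -ltnS h1 leqNgt; apply/negP.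
apply: measurableI => //; apply: measurableD; exact: measurable_code_lt.
Qed.

Lemma measurable_code m s : measurable ([set x | code x m = s] : set (borel X)).
Proof.
have [<-|sm] := eqVneq (size s) m; first exact: measurable_cell.
rewrite (_ : [set _ | _] = set0)//; apply/seteqP; split => // x /= xs.
by move: sm; rewrite -xs size_code eqxx.
Qed.

(* The points whose code is lexicographically smaller than s. *)
Fixpoint lower_set s : set (borel X) :=
  if s is n :: s' then
    lower_set s' `|` (cell s' `&` [set x | (code_at (size s') x < n)%N])
  else set0.

Lemma measurable_lower_set s : measurable (lower_set s).
Proof.
elim: s => //= n s IH; apply: measurableU => //; apply: measurableI.
  exact: measurable_cell.
exact: measurable_code_lt.
Qed.

Lemma lower_set_cell s : lower_set s `&` cell s = set0.
Proof.
elim: s => [|n s IH] /=; first by rewrite set0I.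
apply/seteqP; split=> // x [[xs|[_ /= xn]] [cn cs]].
  by rewrite -IH.
by move: xn; rewrite cn ltnn.
Qed.

Lemma lower_setS n s :
  lower_set (n.+1 :: s) = lower_set (n :: s) `|` cell (n :: s).
Proof.
apply/seteqP; split=> [x [xs|[xs /= xn]]|x [[xs|[xs /= xn]]|[/= cn cs]]].
- by left; left.
- have [cn|cn] := ltnP (code_at (size s) x) n; first by left; right.
  right; rewrite /cell/= xs; congr (_ :: _).
  by apply/eqP; rewrite eqn_leq cn -ltnS xn.
- by left.
- by right; split => //=; exact: ltnW.
- by right; split => //=; rewrite cn.
Qed.

Lemma lower_set_bigcup s :
  \bigcup_n lower_set (n :: s) = lower_set s `|` cell s.
Proof.
apply/seteqP; split=> [x [n _ [?|[? _]]]|x [?|?]]; [by left|by right| |].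
  by exists 0%N => //; left.
by exists (code_at (size s) x).+1 => //; right; split => /=.
Qed.

(** A distribution function for the lexicographic order: an interval starts at the mass of all that
    precedes its cell, so its length is the mass of the cell. *)
Definition measure_tree (mu : probability (borel X) R) s : R :=
  fine (mu (lower_set s)).

Lemma measure_tree_right mu s :
  right_end (measure_tree mu) s = fine (mu (lower_set s `|` cell s)).
Proof.
case: s => [|n s]; last by rewrite -lower_setS.
rewrite set0U (_ : cell _ = setT); last by apply/seteqP; split.
by rewrite probability_setT.
Qed.

Let fine_mu_le (mu : probability (borel X) R) A B : measurable A ->
  measurable B -> A `<=` B -> fine (mu A) <= fine (mu B).
Proof.
move=> mA mB AB; rewrite fine_le ?fin_num_measure//.
by apply: le_measure => //; rewrite inE.
Qed.

Lemma measure_tree_itree mu : interval_tree (measure_tree mu).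
Proof.
have mS s : measurable (lower_set s `|` cell s).
  by apply: measurableU; [exact: measurable_lower_set|exact: measurable_cell].
split.
- by rewrite /measure_tree measure0.
- move=> s; rewrite /measure_tree /= (_ : [set x | _] = set0) ?setI0 ?setU0//.
  by apply/seteqP; split.
- move=> s n; apply: fine_mu_le; [exact: measurable_lower_set..|].
  by rewrite lower_setS; exact: subsetUl.
- move=> s n; rewrite measure_tree_right.
  apply: fine_mu_le => //; first exact: measurable_lower_set.
  by rewrite -lower_set_bigcup => x ?; exists n.
- move=> s m.
  (* Continuity from below along the lower sets of the children. *)
  have : fine (mu (lower_set (n :: s))) @[n --> \oo] -->
      fine (mu (lower_set s `|` cell s)).
    apply: fine_cvg; rewrite fineK ?fin_num_measure// -lower_set_bigcup.
    apply: nondecreasing_cvg_mu => //.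
    + by move=> n; exact: measurable_lower_set.
    + by rewrite lower_set_bigcup.
    + apply/nondecreasing_seqP => n; apply/subsetPset.
      by rewrite lower_setS; exact: subsetUl.
  move=> /cvgrPdist_lt/(_ _ (@exprn2V_gt0 R m))[N _ /(_ N (leqnn N)) /= h].
  exists N; rewrite measure_tree_right (le_trans (ler_norm _))//.
  by rewrite ltW.
Qed.

Lemma measure_tree_cell (mu : probability (borel X) R) s :
  mu (cell s) = (right_end (measure_tree mu) s - measure_tree mu s)%:E.
Proof.
have mc := measurable_cell s; have ml := measurable_lower_set s.
rewrite measure_tree_right /measure_tree measureU//; last exact: lower_set_cell.
by rewrite fineD ?fin_num_measure// addrC addKr fineK ?fin_num_measure.
Qed.

(** Codes under [mu] and branches under Lebesgue measure give each node the same mass, the length of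
    its interval. The code of [x] converges to [x], so the laws of the limits are [mu] and the law
    of the tree. *)
Lemma measure_tree_law mu : tree_law (measure_tree mu) mu.
Proof.
set L := measure_tree mu; have tL : interval_tree L := measure_tree_itree mu.
have [nu nuE] := tree_law_ex tL.
move=> A mA; rewrite -nuE//; apply: eq_borel_probability mA => {}A oA.
rewrite nuE; last exact: borel_open.
have := @eq_coding_law _ _ (borel X) (measurableTypeR R) mu unit_probability
  code (branch L) id (tree_map L) codeS (branchS L) size_code (size_branch L)
  code_dist (tree_map_dist L) measurable_code.
apply => //.
  by move=> m s; exact: (@measurable_branch _ _ _ [set s]).
move=> m s; have [<-|sm] := eqVneq (size s) m; last first.
  rewrite (_ : [set _ | _] = set0); last first.
    apply/seteqP; split => // x /= xs.
    by move: sm; rewrite -xs size_code eqxx.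
  rewrite (_ : [set _ | _] = set0); last first.
    apply/seteqP; split => // x /= xs.
    by move: sm; rewrite -xs size_branch eqxx.
  by rewrite !measure0.
rewrite -/(cell s) measure_tree_cell unit_probabilityE.
have -> : [set t | branch L t (size s) = s] `&` `[0, 1[%classic =
    `[L s, right_end L s[%classic.
  apply/seteqP; split=> [t [/= ts]|t /=]; rewrite !in_itv/=.
    by move=> t01; apply/(branchP _ tL t01).
  move=> ts; have t01 := in_node01 tL ts; split => //.
  exact/(branchP _ tL t01).
rewrite lebesgue_measure_itv/= lte_fin.
have := itree_le_right s tL; rewrite le_eqVlt => /orP[/eqP <-|->//].
by rewrite ltxx subrr.
Qed.

End representation.

(** * Test functions *)

(** Truncation at 1 changes neither small balls nor Cauchy sequences. The bound is what admits the
    first jump from [e 0] in every code. *)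
Lemma bounded_complete_metric (R : realType) (X : topologicalType) :
  completely_metrizable R X -> exists d : X -> X -> R,
    [/\ is_metric d, metrizes d,
        forall u, cauchy_sequence d u -> exists l : X, u @ \oo --> l
      & forall x y, d x y <= 1].
Proof.
move=> [d [[d0 deq dsym dtri] md dc]]; exists (fun x y => Num.min (d x y) 1).
split; last by move=> x y; rewrite ge_min lexx orbT.
- split.
  + by move=> x y; rewrite le_min d0 ler01.
  + move=> x y; split=> [|/deq ->]; last by rewrite min_l.
    rewrite /Order.min; case: ifPn => [_ /deq//|_ /eqP]; by rewrite oner_eq0.
  + by move=> x y; rewrite dsym.
  + move=> x y z; have := dtri x y z; have := d0 x y; have := d0 y z.
    rewrite ge_min /Order.min; case: ifPn => _; case: ifPn => _ h1 h2 h3;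
      apply/orP; by [left|right; lra].
- move=> x A; split=> [/md[r r0 rA]|[r r0 rA]].
    exists (Num.min r 1); first by rewrite lt_min r0 ltr01.
    move=> y /=; rewrite lt_min !gt_min ltxx orbF => /andP[h1 h2]; apply: rA => /=.
    by case/orP : h1 => // h1; apply: lt_trans h2 _.
  by apply/md; exists r => // y /= xy; apply: rA => /=; rewrite gt_min xy.
- move=> u cu; apply: dc => r r0.
  have [|N hN] := cu (Num.min r 1); first by rewrite lt_min r0 ltr01.
  exists N => m n Nm Nn; have := hN m n Nm Nn.
  rewrite lt_min !gt_min ltxx orbF => /andP[/orP[//|h1] h2].
  exact: lt_trans h2 h1.
Qed.

Section test_functions.
Context {R : realType} {X : ptopologicalType} (d : X -> X -> R) (e : nat -> X).
Hypothesis dm : is_metric d.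
Hypothesis md : metrizes d.
Hypothesis de : forall x r, 0 < r -> exists n, d x (e n) < r.

Let d_ge0 x y : 0 <= d x y. Proof. by case: dm. Qed.
Let d_sym x y : d x y = d y x. Proof. by case: dm. Qed.
Let d_tri x y z : d x z <= d x y + d y z. Proof. by case: dm. Qed.

(** Rational height, natural slope, apex in the dense sequence: a countable family. Finite maxima
    with 0 are bounded and approximate nonnegative lower semicontinuous functions from below. *)
Definition cone (p : rat * nat * nat) (x : X) : R :=
  ratr p.1.1 - p.1.2%:R * d x (e p.2).

Definition test_fun (l : seq (rat * nat * nat)) (x : X) : R :=
  \big[Num.max/0]_(p <- l) cone p x.

Lemma continuous_dist z : continuous (d ^~ z).
Proof.
move=> x; apply/cvgrPdist_lt => r r0; apply/md; exists r => // y /= xy.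
have := d_tri x y z; have := d_tri y x z; rewrite (d_sym y x) => h1 h2.
by rewrite ltr_norml; apply/andP; split; lra.
Qed.

Lemma continuous_test_fun l : continuous (test_fun l).
Proof.
elim: l => [|p l IH] x.
  rewrite (_ : test_fun [::] = cst 0); first exact: cvg_cst.
  by apply/funext => y; rewrite /test_fun big_nil.
rewrite (_ : test_fun _ = (fun y => Num.max (cone p y) (test_fun l y))); last first.
  by apply/funext => y; rewrite /test_fun big_cons.
apply: continuous_max; last exact: IH.
by apply: cvgB; [exact: cvg_cst|apply: cvgMr; exact: continuous_dist].
Qed.

Lemma test_fun_ge0 l x : 0 <= test_fun l x.
Proof. by rewrite /test_fun; exact: bigmax_ge_id. Qed.

Lemma test_fun_bounded l : exists M : R, forall x, `|test_fun l x| <= M.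
Proof.
elim: l => [|p l [M IH]].
  by exists 0 => x; rewrite /test_fun big_nil normr0.
exists (Num.max (ratr p.1.1) M) => x.
have := IH x; rewrite !ger0_norm ?test_fun_ge0// => tM.
rewrite {1}/test_fun big_cons -/(test_fun l x) ge_max !le_max tM orbT andbT.
by rewrite /cone gerBl mulr_ge0.
Qed.

Lemma cone_approx (f : X -> R) x r : (forall y, 0 <= f y) ->
  (forall a, a < f x -> \forall y \near x, a < f y) -> 0 < r -> 0 <= f x - r ->
  exists p, (forall y, cone p y <= f y) /\ f x - r < cone p x.
Proof.
move=> f0 lf r0 fr.
have [q] := @rat_in_itvoo R (f x - r) (f x) ltac:(lra).
rewrite in_itv/= => /andP[rq qf].
have /md[a a0 aq] := lf _ qf.
(* A slope so steep that the cone of height [q] is negative at distance [a / 2] or more from its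
   apex. *)
pose c := Num.bound (2 * ratr q / a).
have c0 : 0 <= (c%:R : R) by [].
have cq : 2 * ratr q < c%:R * a :> R.
  rewrite -ltr_pdivrMr// archi_boundP// divr_ge0//; [lra|exact: ltW].
(* The first bound keeps the positive part of the cone within [a] of [x], where [f] exceeds [q]; the
   second keeps the cone above [f x - r] at [x]. *)
pose b := Num.min (a / 2) ((ratr q - (f x - r)) / (c%:R + 1)).
have b0 : 0 < b by rewrite lt_min !divr_gt0//; lra.
have [i xi] := de x b0.
move: xi; rewrite lt_min => /andP[x1 x2]; exists (q, c, i); split => [y|].
  have [h|h] := leP (cone (q, c, i) y) 0; first exact: le_trans (f0 y).
  have cd : c%:R * d y (e i) < ratr q by move: h; rewrite /cone/=; lra.
  have ya : d y (e i) < a / 2.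
    rewrite ltNge; apply/negP => h'.
    have : c%:R * (a / 2) <= c%:R * d y (e i) by exact: ler_wpM2l.
    lra.
  have qy : ratr q < f y.
    by apply: aq => /=; have := d_tri x (e i) y; rewrite (d_sym (e i) y); lra.
  apply: le_trans (ltW qy); rewrite /cone/= gerBl mulr_ge0//.
move: x2; rewrite ltr_pdivlMr; last lra.
by rewrite /cone/=; have := d_ge0 x (e i); lra.
Qed.

(** Use the maximum of those among the first [n] cones that lie below [f]. *)
Lemma test_fun_approx (f : X -> R) : (forall y, 0 <= f y) ->
  (forall x a, a < f x -> \forall y \near x, a < f y) ->
  exists l : nat -> seq (rat * nat * nat),
    (forall n x, test_fun (l n) x <= f x) /\
    (forall x, test_fun (l n) x @[n --> \oo] --> f x).
Proof.
move=> f0 lf.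
exists (fun n =>
  [seq p <- pmap unpickle (iota 0 n) | `[< forall y, cone p y <= f y >]]).
have tf n x : test_fun [seq p <- pmap unpickle (iota 0 n) |
    `[< forall y, cone p y <= f y >]] x <= f x.
  rewrite /test_fun big_filter; apply: bigmax_le => [//|p].
  by move=> /asboolP/(_ x).
split => // x; apply/cvgrPdist_lt => r r0.
(* When [f x < r] any value between 0 and [f x] is close enough, and no cone is required. *)
have [fr|fr] := ltP (f x - r) 0.
  apply: nearW => n; have := tf n x; set t := test_fun _ _ => tx.
  have t0 : 0 <= t by exact: test_fun_ge0.
  by rewrite ger0_norm; lra.
have [p [pf xp]] := cone_approx f0 (lf x) r0 fr.
exists (pickle p).+1 => // n /= pn; have := tf n x; set t := test_fun _ _ => tx.
have pt : cone p x <= t.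
  rewrite /t /test_fun; apply: (@le_bigmax_seq _ _ _ _ 0 p predT (cone ^~ x)) => //.
  rewrite mem_filter; apply/andP; split; first exact/asboolP.
  rewrite mem_pmap; apply/mapP; exists (pickle p); last by rewrite pickleK.
  by rewrite mem_iota.
by rewrite ger0_norm; lra.
Qed.

Let test_fun_measurable l : measurable_fun setT (test_fun l : borel X -> R).
Proof. by apply: continuous_borel; exact: continuous_test_fun. Qed.

Lemma test_fun_integral_approx (f : X -> R) M :
  measurable_fun setT (f : borel X -> R) ->
  (forall y, 0 <= f y) -> (forall y, f y <= M) ->
  (forall x a, a < f x -> \forall y \near x, a < f y) ->
  exists l : nat -> seq (rat * nat * nat),
    (forall n x, test_fun (l n) x <= f x) /\
    forall Q : probability (borel X) R,
      \int[Q]_x (test_fun (l n) : borel X -> R) x @[n --> \oo] -->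
      \int[Q]_x (f : borel X -> R) x.
Proof.
move=> mf f0 fM lf; have [l [lf' lcvg]] := test_fun_approx f0 lf.
exists l; split => // Q; apply: (@probability_Rintegral_cvg _ _ _ _ _ _ M) => //.
- by move=> n x; rewrite ger0_norm ?test_fun_ge0// (le_trans (lf' n x)).
- by apply: aeW => x; exact: lcvg.
Qed.

(** A test function below [f] with nearly the same integral against [P] has convergent integrals,
    which bound those of [f] from below. *)
Let test_integral_liminf (P : probability (borel X) R)
    (P_ : nat -> probability (borel X) R) (f : X -> R) M :
  (forall l, \int[P_ j]_x (test_fun l : borel X -> R) x @[j --> \oo] -->
             \int[P]_x (test_fun l : borel X -> R) x) ->
  continuous f -> (forall y, 0 <= f y) -> (forall y, f y <= M) ->
  forall r, 0 < r -> \forall j \near \oo,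
    \int[P]_x (f : borel X -> R) x - r < \int[P_ j]_x (f : borel X -> R) x.
Proof.
move=> hP cf f0 fM r r0.
have mf := continuous_borel cf.
have lf x a : a < f x -> \forall y \near x, a < f y.
  by move=> afx; apply: cvgr_gt (cf x) _ afx.
have [l [lf' hl]] := test_fun_integral_approx mf f0 fM lf.
have r2 : 0 < r / 2 by rewrite divr_gt0.
have /cvgrPdist_lt/(_ _ r2)[N _ /(_ N (leqnn N))] := hl P.
rewrite /= => /ltr_distlBl hN.
have /cvgrPdist_lt/(_ _ r2) := hP (l N); apply: filterS => j /ltr_distlBl hj.
have : \int[P_ j]_x (test_fun (l N) : borel X -> R) x <=
       \int[P_ j]_x (f : borel X -> R) x.
  apply: le_Rintegral => //.
  - have [M' hM'] := test_fun_bounded (l N).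
    exact: (probability_bounded_integrable _ (test_fun_measurable _) hM').
  - apply: (@probability_bounded_integrable _ _ _ _ _ M) => // x.
    by rewrite ger0_norm.
lra.
Qed.

(* Both f + M and M - f are nonnegative, hence limits from below of test
   functions: this bounds the integrals of f from below and from above. *)
Lemma test_fun_weak_cvg (P : probability (borel X) R)
    (P_ : nat -> probability (borel X) R) (f : X -> R) M :
  (forall l, \int[P_ j]_x (test_fun l : borel X -> R) x @[j --> \oo] -->
             \int[P]_x (test_fun l : borel X -> R) x) ->
  continuous f -> (forall y, `|f y| <= M) ->
  \int[P_ j]_x (f : borel X -> R) x @[j --> \oo] -->
  \int[P]_x (f : borel X -> R) x.
Proof.
move=> hP cf fM; have mf := continuous_borel cf.
have iC (Q : probability (borel X) R) (c : R) : Q.-integrable setT (EFin \o cst c).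
  by apply: (@probability_bounded_integrable _ _ _ _ _ `|c|).
have iF (Q : probability (borel X) R) :
    Q.-integrable setT (EFin \o (f : borel X -> R)).
  exact: (probability_bounded_integrable _ mf fM).
have eC (Q : probability (borel X) R) : \int[Q]_x cst M x = M.
  by rewrite Rintegral_cst// [X in fine X](@probability_setT _ _ _ Q) mulr1.
have eD (Q : probability (borel X) R) :
    \int[Q]_x (f x + cst M x) = \int[Q]_x (f : borel X -> R) x + M.
  by have := RintegralD measurableT (iF Q) (iC Q M); rewrite eC.
have eB (Q : probability (borel X) R) :
    \int[Q]_x (cst M x - f x) = M - \int[Q]_x (f : borel X -> R) x.
  by have := RintegralB measurableT (iC Q M) (iF Q); rewrite eC.
have fMM y : - M <= f y <= M by rewrite -ler_norml.
have h1 := @test_integral_liminf P P_ (fun x => f x + cst M x) (M + M) hP.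
have h2 := @test_integral_liminf P P_ (fun x => cst M x - f x) (M + M) hP.
apply/cvgrPdist_lt => r r0.
have {}h1 : \forall j \near \oo, \int[P]_x (f x + cst M x) - r <
    \int[P_ j]_x (f x + cst M x).
  apply: h1 => //.
  - by move=> x; apply: cvgD; [exact: cf|exact: cvg_cst].
  - by move=> y /=; have /andP[? ?] := fMM y; lra.
  - by move=> y /=; have /andP[? ?] := fMM y; lra.
have {}h2 : \forall j \near \oo, \int[P]_x (cst M x - f x) - r <
    \int[P_ j]_x (cst M x - f x).
  apply: h2 => //.
  - by move=> x; apply: cvgB; [exact: cvg_cst|exact: cf].
  - by move=> y /=; have /andP[? ?] := fMM y; lra.
  - by move=> y /=; have /andP[? ?] := fMM y; lra.
move: h1 h2; apply: filterS2 => j; rewrite !eD !eB => h1 h2.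
by rewrite ltr_norml; apply/andP; split; lra.
Qed.

(** The indicator of an open set is lower semicontinuous, hence a limit of test functions from
    below. *)
Lemma eq_test_fun_integral (P Q : probability (borel X) R) :
  (forall l, \int[P]_x (test_fun l : borel X -> R) x =
             \int[Q]_x (test_fun l : borel X -> R) x) ->
  forall A : set (borel X), measurable A -> P A = Q A.
Proof.
move=> PQ; apply: eq_borel_probability => A oA.
have mA := borel_open oA.
have mI : measurable_fun setT (\1_A : borel X -> R) by exact: measurable_indic.
have [|||l [_ hl]] := @test_fun_integral_approx (\1_A) 1 mI.
- by move=> y; rewrite indicE.
- by move=> y; rewrite indicE lern1 leq_b1.
- move=> x a; rewrite indicE; case: (boolP (x \in A)) => /= xA ax.
    have Ax : nbhs x A by apply: open_nbhs_nbhs; split => //; exact/set_mem.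
    by apply: filterS Ax => y Ay; rewrite indicE mem_set.
  by apply: nearW => y; rewrite indicE (lt_le_trans ax).
have iE (P' : probability (borel X) R) : \int[P']_x \1_A x = fine (P' A).
  by rewrite /Rintegral integral_indic// setIT.
have h : fine (P A) = fine (Q A).
  rewrite -!iE; have hP := hl P; rewrite (_ : (fun n => _) =
    (fun n => \int[Q]_x (test_fun (l n) : borel X -> R) x)) in hP; last first.
    by apply/funext => n; exact: PQ.
  exact: cvg_unique hP (hl Q).
by rewrite -[LHS]fineK ?fin_num_measure// h fineK ?fin_num_measure.
Qed.

End test_functions.

(** * Weak convergence and empirical measures *)

Lemma ptws_cvgP (U : Type) (V : topologicalType) (F : set_system (U -> V))
    (f : U -> V) : Filter F ->
  {ptws, F --> f} <-> forall t, (fun g => g t) @ F --> f t.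
Proof.
move=> FF; rewrite cvg_sup; split=> h t.
  exact: (cvg_comp id _ (h t) (@initial_continuous _ _ (fun g : U -> V => g t) f)).
rewrite cvg_image; last by rewrite eqEsubset; split=> v // _; exists (cst v).
move=> W /h; rewrite ?nbhs_simpl => Q; exists (@^~ t @^-1` W) => //.
by rewrite eqEsubset; split => [j [? + <-//]|j Wj]; exists (fun _ => j).
Qed.

Section prob_space.
Context {R : realType} {X : ptopologicalType}.

Lemma bounded_continuousP (f : bounded_continuous R X) :
  continuous (sval f) /\ exists M, forall x, `|sval f x| <= M.
Proof.
case: f => f [cf [M [_ hM]]] /=; split => //.
by exists (M + 1) => x; apply: hM => //; rewrite ltrDl.
Qed.

Lemma prob_space_cvgP (mu_ : nat -> prob_space R X) (mu : prob_space R X) :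
  mu_ @ \oo --> mu <->
  forall f, integrals (mu_ n) f @[n --> \oo] --> integrals mu f.
Proof.
split=> [h f|h].
  have h1 := cvg_comp _ _ h (@initial_continuous _ _ (@integrals R X) mu).
  by move/ptws_cvgP : h1; exact.
move=> A [_ [[B oB <-] Bmu BA]].
have : (fun n => integrals (mu_ n)) @ \oo -->
    (integrals mu : {ptws bounded_continuous R X -> R}).
  by apply/ptws_cvgP => t; exact: h.
move=> /(_ B (open_nbhs_nbhs (conj oB Bmu))) hB.
have {}hB : \forall n \near \oo, B (integrals (mu_ n)) by [].
by apply: filterS hB => n; exact: BA.
Qed.

End prob_space.

(** * Birkhoff averages *)

Section birkhoff.
Context {R : realType} {X : ptopologicalType} (T : X -> X).

Definition birkhoff (f : X -> R) (x : X) (n : nat) : R :=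
  n.+1%:R^-1 * \sum_(j < n.+1) f (iter j T x).

Lemma integral_empirical x n (f : X -> R) M : continuous f ->
  (forall y, `|f y| <= M) ->
  \int[(empirical_measure R T x n.+1 : probability (borel X) R)]_y
    (f : borel X -> R) y = birkhoff f x n.
Proof.
move=> cf fM; have mf := continuous_borel cf.
set P : probability (borel X) R := empirical_measure R T x n.+1.
have iF : P.-integrable setT (EFin \o (f : borel X -> R)).
  exact: (probability_bounded_integrable _ mf fM).
have iC : P.-integrable setT (EFin \o cst M).
  by apply: (@probability_bounded_integrable _ _ _ _ _ `|M|).
(* Adding the constant [M] reduces to a nonnegative integrand, for which the integral splits over
   the sum of Dirac measures. *)
have := RintegralD measurableT iF iC.
rewrite Rintegral_cst// [X in fine X](@probability_setT _ _ _ P) mulr1.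
suff -> : \int[P]_y (f y + cst M y) = birkhoff (fun y => f y + M) x n.
  move=> /eqP; rewrite -subr_eq => /eqP <-.
  rewrite /birkhoff big_split/= mulrDr sumr_const card_ord -[M *+ _]mulr_natl.
  by rewrite mulKf// addrK.
have mg : measurable_fun setT (fun y : borel X => (f y + M)%:E).
  by apply/measurable_EFinP; apply: measurable_funD.
have g0 y : (0 <= (f y + M)%:E)%E.
  by rewrite lee_fin; have := fM y; rewrite ler_norml => /andP[]; lra.
rewrite /Rintegral /P /empirical_measure ge0_integral_mscale//.
rewrite ge0_integral_measure_sum//.
rewrite (eq_bigr (fun j : 'I_n.+1 => (f (iter j T x) + M)%:E)); last first.
  by move=> j _; rewrite integral_dirac// diracT mul1e.
by rewrite sumEFin.
Qed.

Lemma birkhoff_cvg (f : X -> R) (x_ : nat -> X) x n : continuous T ->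
  continuous f -> x_ @ \oo --> x ->
  birkhoff f (x_ j) n @[j --> \oo] --> birkhoff f x n.
Proof.
move=> cT cf xx; apply: cvgMr; apply: cvg_big => [|i _].
  exact: add_continuous.
apply: (@cvg_comp _ _ _ (fun j => iter i T (x_ j)) f); last exact: cf.
elim: (nat_of_ord i) => [//|k IH].
exact: (cvg_comp _ _ IH (cT _)).
Qed.

(** The difference of the sums telescopes to two boundary terms. *)
Lemma birkhoff_shift (f : X -> R) M x n : (forall y, `|f y| <= M) ->
  `|birkhoff (f \o T) x n - birkhoff f x n| <= 2 * M * n.+1%:R^-1.
Proof.
move=> fM; rewrite /birkhoff -mulrBr -sumrB.
rewrite -(big_mkord xpredT (fun j => f (iter j.+1 T x) - f (iter j T x))).
rewrite telescope_sumr// normrM mulrC [X in _ * X <= _]ger0_norm ?invr_ge0//.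
rewrite ler_wpM2r ?invr_ge0// (le_trans (ler_normB _ _))//.
by have := fM (iter n.+1 T x); have := fM (iter 0 T x); lra.
Qed.

End birkhoff.

Section invariance.
Context {R : realType} {X : ptopologicalType}.

(** The Krylov-Bogolyubov argument: averages of [f] and [f \o T] become equal in the limit, so [mu]
    and its image under [T] agree on test functions. *)
Lemma limit_measures_invariant (T : X -> X) x : polish R X -> continuous T ->
  limit_measures R T x `<=` invariant_measures R T.
Proof.
move=> [sepX [d [dm md _]]] cT mu [phi incphi /prob_space_cvgP hmu].
have [e de] := dense_sequence sepX md.
have mT : measurable_fun setT (T : borel X -> borel X).
  apply: borel_measurable_fun => A oA; apply: borel_open.
  by move/continuousP : cT; exact.
have [nu nuE] := pushforward_probability (mu : probability (borel X) R) mT.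
move=> A mA; rewrite -nuE; move: A mA.
apply: (eq_test_fun_integral dm md de) => l.
set f := test_fun d e l.
have cf : continuous f by exact: continuous_test_fun.
have [M fM] : exists M, forall y, `|f y| <= M by exact: test_fun_bounded.
have cfT : continuous (f \o T).
  by move=> y; apply: continuous_comp; [exact: cT|exact: cf].
rewrite (Rintegral_image mT (fun A _ => nuE A) (continuous_borel cf) fM).
have lim g (cg : continuous g) (gM : forall y, `|g y| <= M) :
    birkhoff T g x (phi k) @[k --> \oo] -->
    \int[(mu : probability (borel X) R)]_y (g : borel X -> R) y.
  have bg : bounded_fun g.
    exists M; split; first exact: num_real.
    by move=> N MN y _ /=; rewrite (le_trans (gM y))// ltW.
  have := hmu (exist _ g (conj cg bg)).
  rewrite (_ : (fun n => _) = (fun k => birkhoff T g x (phi k)))//.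
  by apply/funext => k; exact: (integral_empirical _ _ _ cg gM).
have h1 := lim _ cf fM.
have h2 := lim _ cfT (fun y => fM (T y)).
have h3 : birkhoff T (f \o T) x (phi k) - birkhoff T f x (phi k)
    @[k --> \oo] --> (0 : R).
  have M0 : 0 <= M by apply: le_trans (fM x).
  have phik k : (k <= phi k)%N.
    by elim: k => // k IH; exact: leq_ltn_trans IH (incphi _ _ (ltnSn k)).
  apply/cvgrPdist_lt => r r0.
  (* The added 1 keeps the denominator positive when [M] is 0. *)
  have r' : 0 < r / (2 * M + 1) by rewrite divr_gt0//; lra.
  apply: filterS (near_infty_natSinv_lt (PosNum r')) => k /= kr.
  rewrite sub0r normrN (le_lt_trans (birkhoff_shift _ _ _ fM))//.
  have kphi : (phi k).+1%:R^-1 <= k.+1%:R^-1 :> R.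
    by rewrite lef_pV2 ?posrE// ler_nat ltnS.
  have := ler_wpM2l (_ : 0 <= 2 * M) kphi; rewrite mulr_ge0// => /(_ isT) h.
  apply: le_lt_trans h _; move: kr; rewrite ltr_pdivlMr; last lra.
  have : 0 <= k.+1%:R^-1 :> R by rewrite invr_ge0.
  by move: (k.+1%:R^-1) => c; nra.
apply/eqP; rewrite -subr_eq0; apply/eqP.
exact: (cvg_unique (@Rhausdorff R) (cvgB h2 h1) h3).
Qed.

End invariance.

(** * Analyticity *)

Section coded_relation.
Context {R : realType} {X : ptopologicalType} (d : X -> X -> R) (e : nat -> X).
Hypothesis dm : is_metric d.
Hypothesis md : metrizes d.
Hypothesis dc : forall u, cauchy_sequence d u -> exists l : X, u @ \oo --> l.
Hypothesis d_le1 : forall x y, d x y <= 1.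
Hypothesis de : forall x r, 0 < r -> exists n, d x (e n) < r.
Context (T : X -> X) (cT : continuous T) (W : set (prob_space R X)).
Hypothesis oW : open W.

Implicit Types (L : seq nat -> R) (N : seq nat * nat -> nat).

(* Being an interval tree is not a closed condition, but it becomes one once
   the rates N at which the children exhaust their parent are prescribed. *)
Definition tree_rate L N := [/\ L [::] = 0, forall s, L (0%N :: s) = L s,
  forall s n, L (n :: s) <= L (n.+1 :: s), forall s n, L (n :: s) <= right_end L s
  & forall s m, right_end L s - L (N (s, m) :: s) <= 2 ^- m].

Lemma tree_rate_itree L N : tree_rate L N -> interval_tree L.
Proof. by case=> ? ? ? ? h; split=> // s m; exists (N (s, m)). Qed.

Lemma itree_tree_rate L : interval_tree L -> exists N, tree_rate L N.
Proof.
move=> tL; have /choice[N hN] (sm : seq nat * nat) :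
    exists n, right_end L sm.1 - L (n :: sm.1) <= 2 ^- sm.2.
  exact: itree_exhaust.
by exists N; case: tL => ? ? ? ? _; split=> // s m; exact: (hN (s, m)).
Qed.

Lemma tree_rate_closed (L_ : nat -> seq nat -> R)
    (N_ : nat -> seq nat * nat -> nat) L N :
  (forall s, L_ ^~ s @ \oo --> L s) ->
  (forall p, \forall j \near \oo, N_ j p = N p) ->
  (forall j, tree_rate (L_ j) (N_ j)) -> tree_rate L N.
Proof.
move=> LL NN tL.
have RR s : right_end (L_ j) s @[j --> \oo] --> right_end L s.
  by case: s => [|n s]; [exact: cvg_cst|exact: LL].
split.
- apply: (cvg_unique (@Rhausdorff R) (LL [::])).
  rewrite (_ : L_ ^~ [::] = cst 0); first exact: cvg_cst.
  by apply/funext => j; have [] := tL j.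
- move=> s; apply: (cvg_unique (@Rhausdorff R) (LL (0%N :: s))).
  rewrite (_ : L_ ^~ (0%N :: s) = L_ ^~ s); first exact: LL.
  by apply/funext => j; have [] := tL j.
- move=> s n; apply: ler_cvg_to (LL (n :: s)) (LL (n.+1 :: s)) _.
  by apply: nearW => j; have [] := tL j.
- move=> s n; apply: ler_cvg_to (LL (n :: s)) (RR s) _.
  by apply: nearW => j; have [] := tL j.
- move=> s m; apply: ler_cvg_to (cvgB (RR s) (LL (N (s, m) :: s))) (cvg_cst _) _.
  apply: filterS (NN (s, m)) => j jN; have [_ _ _ _ /(_ s m)] := tL j.
  by rewrite jN.
Qed.

(** The non-strict inequality makes the condition pass to limits. *)
Definition averages_near x L (phi : nat -> nat) := forall k l, (pickle l <= k)%N ->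
  `|birkhoff T (test_fun d e l) x (phi k) -
    \int[unit_probability]_t test_fun d e l (tree_map d e L t)| <= 2 ^- k.

Lemma averages_near_closed x_ (L_ : nat -> seq nat -> R) phi_ x L phi :
  x_ @ \oo --> x -> (forall s, L_ ^~ s @ \oo --> L s) ->
  (forall k, \forall j \near \oo, phi_ j k = phi k) ->
  interval_tree L -> (forall j, interval_tree (L_ j)) ->
  (forall j, averages_near (x_ j) (L_ j) (phi_ j)) -> averages_near x L phi.
Proof.
move=> xx LL pp tL tL_ h k l lk.
have cf : continuous (test_fun d e l) by exact: continuous_test_fun.
have [M fM] : exists M, forall y, `|test_fun d e l y| <= M.
  exact: test_fun_bounded.
have h1 := @birkhoff_cvg _ _ T _ _ _ (phi k) cT cf xx.
have h2 := tree_integral_cvg (e := e) dm md dc tL tL_ LL cf fM.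
rewrite leNgt; apply/negP => /(cvgr_gt _ (cvg_norm (cvgB h1 h2))) far.
have [j [jp]] := filter_ex (filterI (pp k) far).
by have := h j k l lk; rewrite jp leNgt => /negP.
Qed.

(* An open condition turned into a closed one by the parameter m, which
   measures the size of a neighbourhood of L on which it holds. *)
Definition inside_at L (m : nat) := forall L' (mu : probability (borel X) R),
  interval_tree L' -> tree_law d e L' mu -> ~ W mu ->
  exists s, (pickle s < m)%N /\ 2 ^- m <= `|L s - L' s|.

(** A bad tree strictly within [2 ^- m] of [L] on finitely many nodes would be equally close to
    [L_ j] for large [j]. *)
Lemma inside_at_closed (L_ : nat -> seq nat -> R) L m_ m :
  (forall s, L_ ^~ s @ \oo --> L s) ->
  (\forall j \near \oo, m_ j = m) -> (forall j, inside_at (L_ j) (m_ j)) ->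
  inside_at L m.
Proof.
move=> LL mm h L' mu tL' muL' nW; apply: contrapT => nex.
have close (s : seq nat) :
    \forall j \near \oo, (pickle s < m)%N -> `|L_ j s - L' s| < 2 ^- m.
  have [sm|sm] := ltnP (pickle s) m; last by apply: nearW.
  have lt : `|L s - L' s| < 2 ^- m.
    by rewrite ltNge; apply/negP => ?; apply: nex; exists s.
  have cs : (fun _ : nat => L' s) @ \oo --> L' s by exact: cvg_cst.
  have near_s : \forall j \near \oo, `|L_ j s - L' s| < 2 ^- m.
    exact: (cvgr_lt _ (cvg_norm (cvgB (LL s) cs)) _ lt).
  by apply: filterS near_s => j hj _.
have [j [jm hj]] := filter_ex (filterI mm (near_pickle_lt close m)).
have [s [sm]] := h j _ _ tL' muL' nW; rewrite jm in sm *.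
by rewrite leNgt hj.
Qed.

Lemma tree_law_inside L (mu : probability (borel X) R) m : interval_tree L ->
  tree_law d e L mu -> inside_at L m -> W mu.
Proof.
move=> tL muL h; apply: contrapT => /(h _ _ tL muL)[s [_]].
by rewrite subrr normr0 leNgt exprn2V_gt0.
Qed.

(** Otherwise trees with laws outside [W] converge to [L] at every node; their laws then converge
    weakly to [mu] and enter the open set [W]. *)
Lemma inside_tree_law L (mu : probability (borel X) R) : interval_tree L ->
  tree_law d e L mu -> W mu -> exists m, inside_at L m.
Proof.
move=> tL muL Wmu; apply: contrapT => nex.
have /choice[L_ hL] (m : nat) : exists L', exists mu' : probability (borel X) R,
    [/\ interval_tree L', tree_law d e L' mu', ~ W mu' &
      forall s, (pickle s < m)%N -> `|L s - L' s| < 2 ^- m].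
  apply: contrapT => nL; apply: nex; exists m => L' mu' tL' muL' nW.
  apply: contrapT => ns; apply: nL; exists L', mu'; split=> // s sm.
  by rewrite ltNge; apply/negP => ?; apply: ns; exists s.
have {hL}/choice[mu_ hL] := hL.
have LL s : L_ ^~ s @ \oo --> L s.
  apply/cvgrPdist_lt => r r0; have [m mr] := exists_exprn2V_lt r0.
  exists (maxn m (pickle s).+1) => // j /=; rewrite geq_max => /andP[mj sj].
  have [_ _ _ /(_ s sj)] := hL j; move/lt_trans; apply.
  exact: le_lt_trans (exprn2V_le mj) mr.
have tL_ j : interval_tree (L_ j) by have [] := hL j.
have : (fun j => mu_ j : prob_space R X) @ \oo --> (mu : prob_space R X).
  apply/prob_space_cvgP => f; have [cf [M fM]] := bounded_continuousP f.
  have lawE L' (mu' : probability (borel X) R) : interval_tree L' ->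
      tree_law d e L' mu' -> integrals mu' f =
      \int[unit_probability]_t sval f (tree_map d e L' t).
    by move=> tL' muL'; exact: (tree_law_integral dm md dc tL' muL' cf fM).
  rewrite (lawE _ _ tL muL) (_ : (fun n => integrals (mu_ n) f) =
    (fun n => \int[unit_probability]_t sval f (tree_map d e (L_ n) t))).
    exact: (tree_integral_cvg dm md dc tL tL_ LL cf fM).
  by apply/funext => n; apply: lawE => //; have [] := hL n.
move=> /(_ W (open_nbhs_nbhs (conj oW Wmu))) hW.
have {}hW : \forall j \near \oo, W (mu_ j) by [].
have [j Wj] := filter_ex hW.
by have [_ _ /(_ Wj)] := hL j.
Qed.

(** One family [v] packs all natural parameters: the neighbourhood size at [inl (inl tt)], the
    subsequence at [inl (inr k)], the exhaustion rates at [inr p]. *)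
Definition coded_limit x L (v : unit + nat + seq nat * nat -> nat) :=
  [/\ tree_rate L (fun p => v (inr p)),
      forall k, (v (inl (inr k)) < v (inl (inr k.+1)))%N,
      averages_near x L (fun k => v (inl (inr k)))
    & inside_at L (v (inl (inl tt)))].

Lemma coded_limit_closed x_ (L_ : nat -> seq nat -> R) v_ x L v :
  x_ @ \oo --> x -> (forall s, L_ ^~ s @ \oo --> L s) ->
  (forall p, \forall j \near \oo, v_ j p = v p) ->
  (forall j, coded_limit (x_ j) (L_ j) (v_ j)) -> coded_limit x L v.
Proof.
move=> xx LL vv h.
have tr : tree_rate L (fun p => v (inr p)).
  apply: (tree_rate_closed LL (fun p => vv (inr p))) => j; by have [] := h j.
split => //.
- move=> k; have [j [j1 j2]] := filter_ex (filterI (vv (inl (inr k)))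
    (vv (inl (inr k.+1)))).
  by rewrite -j1 -j2; have [] := h j.
- apply: (averages_near_closed xx LL (fun k => vv (inl (inr k)))) => [|j|j].
  + exact: tree_rate_itree tr.
  + by have [/tree_rate_itree] := h j.
  + by have [] := h j.
- by apply: (inside_at_closed LL (vv (inl (inl tt)))) => j; have [] := h j.
Qed.

Lemma coded_limit_measure x L v : coded_limit x L v ->
  (limit_measures R T x `&` W) !=set0.
Proof.
move=> [/tree_rate_itree tL incv av ins].
have [mu muL] := tree_law_ex e dm md dc tL.
exists mu; split; last exact: tree_law_inside muL ins.
exists (fun k => v (inl (inr k))); first exact: (homo_ltn ltn_trans incv).
apply/prob_space_cvgP => f; have [cf [M fM]] := bounded_continuousP f.
apply: (test_fun_weak_cvg dm md de _ cf fM) => l.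
have ct : continuous (test_fun d e l) by exact: continuous_test_fun.
have [M' tM] : exists M, forall y, `|test_fun d e l y| <= M.
  exact: test_fun_bounded.
rewrite (tree_law_integral dm md dc tL muL ct tM).
apply/cvgrPdist_lt => r r0; have [m mr] := exists_exprn2V_lt r0.
exists (maxn m (pickle l)) => // k /=; rewrite geq_max => /andP[mk lk].
rewrite (integral_empirical _ _ _ ct tM) distrC.
apply: le_lt_trans (av k l lk) _; exact: le_lt_trans (exprn2V_le mk) mr.
Qed.

Lemma limit_measure_coded x mu : limit_measures R T x mu -> W mu ->
  exists L v, coded_limit x L v.
Proof.
move=> [phi incphi /prob_space_cvgP hmu] Wmu.
pose L := measure_tree de (mu : probability (borel X) R).
have tL : interval_tree L by exact: measure_tree_itree.
have muL : tree_law d e L mu by exact: measure_tree_law.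
have [N hN] := itree_tree_rate tL.
have [m hm] := inside_tree_law tL muL Wmu.
have near_l k (l : seq (rat * nat * nat)) : \forall j \near \oo,
    `|birkhoff T (test_fun d e l) x (phi j) -
      \int[unit_probability]_t test_fun d e l (tree_map d e L t)| <= 2 ^- k.
  have ct : continuous (test_fun d e l) by exact: continuous_test_fun.
  have [M tM] : exists M, forall y, `|test_fun d e l y| <= M.
    exact: test_fun_bounded.
  have bt : bounded_fun (test_fun d e l).
    exists M; split; first exact: num_real.
    by move=> M' MM' y _ /=; rewrite (le_trans (tM y))// ltW.
  have := hmu (exist _ _ (conj ct bt)).
  move=> /cvgrPdist_lt/(_ _ (@exprn2V_gt0 R k)); apply: filterS => j.
  rewrite /integrals/= (tree_law_integral dm md dc tL muL ct tM).
  by rewrite (integral_empirical _ _ _ ct tM) distrC => /ltW.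
have /choice[M hM] (k : nat) : exists M : nat, forall j, (M <= j)%N ->
    forall l, (pickle l < k.+1)%N ->
    `|birkhoff T (test_fun d e l) x (phi j) -
      \int[unit_probability]_t test_fun d e l (tree_map d e L t)| <= 2 ^- k.
  by have [M _ hM] := near_pickle_lt (near_l k) k.+1; exists M.
(* Partial sums make the choice strictly increasing in [k] while keeping it at least [M k]. *)
pose theta k := (\sum_(i < k.+1) (M i).+1)%N.
exists L, (fun p => match p with
  | inl (inl _) => m | inl (inr k) => phi (theta k) | inr p => N p end).
split=> //= [k|k l lk].
  by apply: incphi; rewrite /theta [ltnRHS]big_ord_recr/= addnS ltnS leq_addr.
apply: hM => //; rewrite /theta big_ord_recr/=.
by apply: leq_trans (leqnSn _) _; exact: leq_addl.
Qed.

End coded_relation.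

Theorem fact18 (R : realType) (X : ptopologicalType) (T : X -> X)
    (polishX : polish R X) (contT : continuous T)
    (U : set (prob_space R X))
    (subU : U `<=` invariant_measures R T)
    (openU : open (U : set (subspace (invariant_measures R T)))) :
  analytic R [set x : X | limit_measures R T x `&` U !=set0].
Proof.
have [W oW WU] := (open_subspaceP _ _).1 openU.
have [sepX /bounded_complete_metric[d [dm md dc d_le1]]] := polishX.
have [e de] := dense_sequence sepX md.
rewrite (_ : [set x | _] = [set x | exists L v, coded_limit d e T W x L v]).
  apply: analytic_projection => // x_ L_ v_ x L v xx LL vv h.
  exact: (coded_limit_closed dm md dc contT xx LL vv h).
have inv := limit_measures_invariant polishX contT.
apply/seteqP; split=> [x [mu [xmu Umu]]|x [L [v]]].
  have [Wmu _] : (W `&` invariant_measures R T) mu.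
    by rewrite WU; split => //; exact: subU.
  exact: (limit_measure_coded dm md dc d_le1 de oW xmu Wmu).
move=> /(coded_limit_measure dm md dc de)[mu [xmu Wmu]]; exists mu; split => //.
have [//] : (U `&` invariant_measures R T) mu.
by rewrite -WU; split => //; exact: inv xmu.
Qed.
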